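(* Let $\mathcal{H}=L^2(\mathbb{R}^\times,dt/|t|)$ and $G=\mathbb{R}\rtimes\mathbb{R}^\times$. Let $\xi_i,\eta_i\in\mathcal{H}$ for $i=1,2$. Then $$(\xi_1*_\pi\eta_1)\cdot(\xi_2*_\pi\eta_2)=\int_{\mathbb{R}^\times}\bigl[\lambda(1+h)\xi_1\cdot\lambda(1+h^{-1})\xi_2\bigr]*_\pi\bigl[\lambda(1+h)\eta_1\cdot\lambda(1+h^{-1})\eta_2\bigr]\,\frac{dh}{|h|},$$ where the right-hand side is defined as the Bochner integral of an $\mathrm{A}_\pi(G)$-valued function.
   Context: $\mathbb{R}^\times$ is the multiplicative group of non-zero reals with Haar measure $dt/|t|$; $\mathcal{H}=L^2(\mathbb{R}^\times,dt/|t|)$, with inner product linear in the first variable. For $r\in\mathbb{R}^\times$, $(\lambda(r)\xi)(t)=\xi(r^{-1}t)$, and $f\cdot g$ denotes pointwise product of functions. $G=\mathbb{R}\rtimes\mathbb{R}^\times=\{(b,a):b\in\mathbb{R},a\in\mathbb{R}^\times\}$ with multiplication $(b,a)(b',a')=(ab'+b,aa')$. The unitary representation $\pi$ of $G$ on $\mathcal{H}$ is $(\pi(b,a)\xi)(t)=e^{2\pi i bt}\xi(ta)$. The coefficient function $\xi*_\pi\eta\in C_b(G)$ is $(\xi*_\pi\eta)(b,a)=\langle\pi(b,a)\xi,\eta\rangle$. With $\overline{\mathcal{H}}$ the conjugate Hilbert space and $\widehat{\otimes}$ the projective tensor product, $\Psi:\mathcal{H}\widehat{\otimes}\overline{\mathcal{H}}\to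 C_b(G)$ is the contraction with $\Psi(\xi\otimes\eta)=\xi*_\pi\eta$, and $\mathrm{A}_\pi(G)$ is the range of $\Psi$ equipped with the quotient norm from $(\mathcal{H}\widehat{\otimes}\overline{\mathcal{H}})/\ker\Psi$. (The integrand is $\mathrm{A}_\pi(G)$-valued for a.e. $h$.) *)

(* Defs.v *)
From HB Require Import structures.
From mathcomp Require Import all_boot all_order all_algebra.
From mathcomp Require Import complex.
From mathcomp Require Import all_classical all_reals all_analysis.
From mathcomp Require Import measurable_realfun.

Set Implicit Arguments.
Unset Strict Implicit.
Unset Printing Implicit Defensive.

Import Order.TTheory GRing.Theory Num.Theory.
Import numFieldNormedType.Exports.
Import ComplexField.Normc.

Local Open Scope classical_set_scope.
Local Open Scope complex_scope.
Local Open Scope ring_scope.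

(* The Haar measure dt/|t| of R^*, as a measure on R.  As {0} is a null set,
   a function on R^* is represented by any of its extensions to R. *)
Definition haar {R : realType} (A : set R) : \bar R :=
  (\int[lebesgue_measure]_(t in A) (`|t|^-1)%:E)%E.

Section haar_measure.
Variable R : realType.

Let measurable_haar_density :
  measurable_fun [set: R] (fun t : R => (`|t|^-1)%:E : \bar R).
Proof.
apply/measurable_EFinP.
rewrite (_ : (fun t : R => `|t|^-1) = (fun t : R => `|t| `^ (-1))).
  by apply: (measurableT_comp (measurable_powR (-1))); exact: normr_measurable.
by apply/funext => t; rewrite powR_inv1.
Qed.

Let haar0 : haar (set0 : set R) = 0%E.
Proof. exact: integral_set0. Qed.

Let haar_ge0 (A : set R) : (0 <= haar A)%E.
Proof. by apply: integral_ge0 => t _; rewrite lee_fin invr_ge0. Qed.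

Let haar_sigma_additive : semi_sigma_additive (@haar R).
Proof.
move=> /= F mF tF mUF; rewrite /haar; apply: cvg_toP.
  apply: ereal_nondecreasing_is_cvgn => m n mn.
  by apply: lee_sum_nneg_natr => // k _ _; exact: haar_ge0.
rewrite ge0_integral_bigcup//=.
exact: measurable_funS measurable_haar_density.
Qed.

HB.instance Definition _ := isMeasure.Build _ _ _ (@haar R)
  haar0 haar_ge0 haar_sigma_additive.

End haar_measure.

Section hilbert_space.
Variable R : realType.
Implicit Types (xi eta : R -> R[i]) (r : R).

Definition L2norm xi : \bar R :=
  'N[@haar R]_2%:E[(fun t => (normc (xi t))%:E)]%E.

(* xi is a representative of an element of L^2(R^*, dt/|t|). *)
Definition L2 xi : Prop :=
  [/\ measurable_fun setT (fun t => complex.Re (xi t)),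
      measurable_fun setT (fun t => complex.Im (xi t)) &
      (L2norm xi < +oo)%E].

Definition Cintegral (f : R -> R[i]) : R[i] :=
  Rintegral (@haar R) setT (fun t => complex.Re (f t)) +i*
  Rintegral (@haar R) setT (fun t => complex.Im (f t)).

Definition inner xi eta : R[i] := Cintegral (fun t => xi t * (eta t)^*).

Definition lambda r xi : R -> R[i] := fun t => xi (r^-1 * t).

End hilbert_space.

(* The elements (b, a) of the semidirect product of R and R^*. *)
Record affine (R : realType) :=
  Affine { translation : R; dilation : R; dilation_neq0 : dilation != 0 }.

Section representation.
Variable R : realType.
Implicit Types (g h : affine R) (xi eta : R -> R[i]).

Definition affine_mul g h : affine R :=
  Affine (dilation g * translation h + translation g)
         (mulf_neq0 (dilation_neq0 g) (dilation_neq0 h)).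

Definition cis (x : R) : R[i] := cos x +i* sin x.

Definition rep g xi : R -> R[i] :=
  fun t => cis (2 * pi * translation g * t) * xi (t * dilation g).

Lemma rep_mul g h xi : rep (affine_mul g h) xi = rep g (rep h xi).
Proof.
apply/funext => t; rewrite /rep /= [t * (_ * _)]mulrA [RHS]mulrA.
congr (_ * _); rewrite /cis.
set x := (2 * pi * translation g * t).
set y := (2 * pi * translation h * (t * dilation g)).
have -> : 2 * pi * (dilation g * translation h + translation g) * t = x + y.
  rewrite /x /y mulrDr mulrDl addrC; congr (_ + _).
  by rewrite (mulrC (dilation g)) !mulrA mulrAC.
by rewrite cosD sinD; apply/eqP; rewrite eq_complex /= eqxx /= addrC.
Qed.

Definition coef xi eta : affine R -> R[i] := fun g => inner (rep g xi) eta.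

End representation.

(* The projective tensor product of H and its conjugate, realized in the dual
   of the bounded bilinear forms on H x conj(H): the tensor x is identified
   with B |-> <B, x>, so that xi (x) eta is B |-> B xi eta.  Its elements are
   the sums of series of elementary tensors with
   sum_n |xi_n| |eta_n| < oo, and its norm is the infimum of these sums. *)
Section projective_tensor_product.
Variable R : realType.
Implicit Types (xi eta : R -> R[i]) (us vs : nat -> R -> R[i]).

Definition form := (R -> R[i]) -> (R -> R[i]) -> R[i].

(* Bilinear on H x conj(H), i.e., sesquilinear on H x H.  Boundedness makes B
   compatible with almost everywhere equality. *)
Definition bounded_form (B : form) : Prop :=
  [/\ forall (c : R[i]) xi xi' eta, L2 xi -> L2 xi' -> L2 eta ->
        B (c *: xi + xi') eta = c * B xi eta + B xi' eta,
      forall (c : R[i]) xi eta eta', L2 xi -> L2 eta -> L2 eta' ->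
        B xi (c *: eta + eta') = c^* * B xi eta + B xi eta' &
      exists M : R, forall xi eta, L2 xi -> L2 eta ->
        ((normc (B xi eta))%:E <= M%:E * (L2norm xi * L2norm eta))%E].

Definition tensor_weight us vs : \bar R :=
  (\sum_(0 <= n <oo) (L2norm (us n) * L2norm (vs n)))%E.

Definition tensor_series (x : form -> R[i]) us vs : Prop :=
  [/\ forall n, L2 (us n), forall n, L2 (vs n),
      (tensor_weight us vs < +oo)%E &
      forall B, bounded_form B ->
        series (fun n => (B (us n) (vs n) : R[i]^o)) @ \oo --> (x B : R[i]^o)].

Definition projective_tensor (x : form -> R[i]) : Prop :=
  exists us vs, tensor_series x us vs.

Definition projective_norm (x : form -> R[i]) : \bar R :=
  ereal_inf [set s | exists us vs,
    tensor_series x us vs /\ s = tensor_weight us vs].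

(* Psi (xi (x) eta) = coef xi eta. *)
Definition Psi (x : form -> R[i]) : affine R -> R[i] :=
  fun g => x (fun xi eta => coef xi eta g).

Definition Api (u : affine R -> R[i]) : Prop :=
  exists x, projective_tensor x /\ Psi x = u.

(* The quotient norm; it is +oo outside Api. *)
Definition Api_norm (u : affine R -> R[i]) : \bar R :=
  ereal_inf [set projective_norm x
            | x in [set x | projective_tensor x /\ Psi x = u]].

End projective_tensor_product.

Arguments Api {R}.
Arguments Api_norm {R}.

(* Bochner integration for functions with values in the normed space
   {v : V | N v < +oo}, for an extended-real valued norm N on V. *)
Section bochner.
Context d (T : measurableType d) (R : realType).
Variables (mu : {measure set T -> \bar R}) (V : lmodType R[i]).
Variable N : V -> \bar R.

Record step := Step {
  step_size : nat;
  step_set : 'I_step_size -> set T;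
  step_val : 'I_step_size -> V }.

Definition step_integrable (s : step) : Prop :=
  forall k : 'I_(step_size s),
    [/\ measurable (step_set k), (mu (step_set k) < +oo)%E &
        (N (step_val k) < +oo)%E].

Definition step_fun (s : step) (h : T) : V :=
  \sum_(k < step_size s) (\1_(step_set k) h)%:C *: step_val k.

Definition step_integral (s : step) : V :=
  \sum_(k < step_size s) (fine (mu (step_set k)))%:C *: step_val k.

(* f is Bochner integrable with integral v.  The values of f on a null set
   are irrelevant. *)
Definition is_bochner_integral (f : T -> V) (v : V) : Prop :=
  exists s : nat -> step,
    [/\ forall n, step_integrable (s n),
        {ae mu, forall h, N (f h - step_fun (s n) h) @[n --> \oo] --> 0%E},
        (\int[mu]_h N (f h - step_fun (s n) h))%E @[n --> \oo] --> 0%E &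
        N (v - step_integral (s n)) @[n --> \oo] --> 0%E].

End bochner.

(* Main.v *)
Require Import Defs.
From HB Require Import structures.
From mathcomp Require Import all_boot all_order all_algebra.
From mathcomp Require Import complex.
From mathcomp Require Import all_classical all_reals all_analysis.
From mathcomp Require Import measurable_realfun.
From mathcomp Require finmap.
From mathcomp Require Import ring lra.

Import Order.TTheory GRing.Theory Num.Theory.
Import numFieldNormedType.Exports.
Import ComplexField.Normc.

Local Open Scope classical_set_scope.
Local Open Scope complex_scope.
Local Open Scope ring_scope.

Set Implicit Arguments.
Unset Strict Implicit.
Unset Printing Implicit Defensive.

(** For h outside {0, -1}, write [F h] and [K h] for the products of dilates in
    the theorem.  The substitution t = s + u, h = u / s turns
    dt / |t| dh / |h| into ds / |s| du / |u|, and the two dilates evaluated at t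
    become [xi1 s] and [xi2 u].  Two consequences follow.  The integral over h of
    the squared norm of [F h] is the product of the squared norms of [xi1] and
    [xi2], so h |-> [F h] and h |-> [K h] are square-integrable fields of
    vectors.  And, since the character satisfies e(bt) = e(bs) e(bu), Fubini's
    theorem gives the identity at each point g of the group
    ([coef_product_integral]).

    It remains to upgrade this pointwise identity to a Bochner integral, and this
    part holds for all square-integrable fields X and Y
    ([bochner_integral_coef]).  The quotient norm of a coefficient is at most
    the product of the two vector norms, so it suffices to approximate X and Y in
    the square mean by fields that take finitely many values, each on a
    measurable set.  Such approximations exist because rectangles generate
    the measurable sets of a product ([approximable_L2]).  With n-th squared
    errors of order 4^-n, the mean distance between the n-th step function and
    h |-> coef (X h) (Y h) is summable over n, whence both the convergence
    almost everywhere and the convergence in mean.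

    The last requirement is that the integrals S n of the step functions tend
    to the product v of the coefficients in the quotient norm, although v is only
    known pointwise.  On a common refinement of the two partitions, the increment
    S (n + 1) - S n is the image of an explicit finite sum of elementary tensors
    of weight O(2^-n).  Concatenating the increments from n on yields a tensor of
    weight O(2^-n) whose image is v - S n, because its partial images are
    S (n + k) - S n and S (n + k) converges to v pointwise ([Api_series]). *)

(** * The Haar measure of the multiplicative group *)

Section haar_measure_theory.
Variable R : realType.
Local Notation mu := (@haar R).
Local Notation leb := (@lebesgue_measure R).

Lemma measurable_inv : measurable_fun setT (fun t : R => t^-1).
Proof.
(* The inverse of 0 is 0, so the formula t / t ^ 2 holds everywhere. *)
rewrite (_ : (fun t : R => t^-1) = (fun t => t * (`|t| `^ (-1) * `|t| `^ (-1)))).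
  have m : measurable_fun setT (fun t : R => `|t| `^ (-1)).
    by apply: (measurableT_comp (measurable_powR (-1))); exact: normr_measurable.
  by apply: measurable_funM => //; exact: measurable_funM.
apply/funext => t; rewrite powR_inv1// -invfM -expr2 real_normK ?num_real//.
have [->|t0] := eqVneq t 0; first by rewrite invr0 mul0r.
by field.
Qed.

Lemma measurable_scale (c : R) : measurable_fun setT (fun t : R => c * t).
Proof. exact: measurable_funM. Qed.

(** By uniqueness of Lebesgue measure: the rescaled image measure has the same
    values on half-open intervals. *)
Lemma lebesgue_scale (c : R) (A : set R) : c != 0 -> measurable A ->
  (`|c|%:E * leb ((fun t => (c * t)%R) @^-1` A) = leb A)%E.
Proof.
move=> c0 mA.
have [m Hm] : exists m : {measure set (measurableTypeR R) -> \bar R},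
    forall X, m X = (`|c|%:E * leb ((fun t => (c * t)%R) @^-1` X))%E.
  unshelve eexists (mscale (NngNum (normr_ge0 c))
    (pushforward (@lebesgue_measure R) (fun t : measurableTypeR R => c * t : measurableTypeR R))).
    exact: measurable_scale.
  by move=> X; rewrite /mscale /= /pushforward.
rewrite -Hm; apply/esym/lebesgue_measure_unique => //.
move=> _ [[a b] _ <-] /=; rewrite Hm.
have [cp|cn|ceq] := ltgtP 0 c; last by rewrite ceq eqxx in c0.
- have -> : (fun t => c * t) @^-1` `]a, b] = `]a / c, b / c]%classic.
    by apply/seteqP; split => x /=; rewrite !in_itv/= ltr_pdivrMr// ler_pdivlMr// mulrC.
  rewrite !lebesgue_measure_itv/= !lte_fin ltr_pM2r ?invr_gt0//.
  case: ifP => _; last by rewrite mule0.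
  by rewrite -!EFinB -EFinM gtr0_norm//; congr EFin; field.
- have -> : (fun t => c * t) @^-1` `]a, b] = `[b / c, a / c[%classic.
    apply/seteqP; split => x /=; rewrite !in_itv/= ltr_ndivlMr// ler_ndivrMr// mulrC => /andP[? ?];
      exact/andP.
  rewrite !lebesgue_measure_itv/= !lte_fin ltr_nM2r ?invr_lt0//.
  case: ifP => _; last by rewrite mule0.
  by rewrite -!EFinB -EFinM ltr0_norm//; congr EFin; field.
Qed.

Lemma measurable_density : measurable_fun setT (fun t : R => (`|t|^-1)%:E : \bar R).
Proof.
apply/measurable_EFinP; apply: (measurableT_comp measurable_inv).
exact: normr_measurable.
Qed.

(** The density 1 / |t| compensates the factor |c| by which a dilation scales
    Lebesgue measure. *)
Lemma haar_scale (c : R) (A : set R) : c != 0 -> measurable A ->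
  mu ((fun t => c * t) @^-1` A) = mu A.
Proof.
move=> c0 mA; rewrite /haar.
pose p := fun t : R => c * t.
have mp : measurable_fun setT p by exact: measurable_scale.
have -> : (\int[leb]_(t in p @^-1` A) (`|t|^-1)%:E =
          \int[leb]_(t in p @^-1` A) (((fun y => `|c|%:E * (`|y|^-1)%:E) \o p) t))%E.
  apply: eq_integral => t _ /=; rewrite -EFinM /p normrM invfM mulrA mulfV ?mul1r//.
  by rewrite normr_eq0.
have md : measurable_fun A (fun y : R => (`|c|%:E * (`|y|^-1)%:E)%E).
  apply: measurable_funS (measurableT) _ _ => //.
  by apply: measurable_funeM; exact: measurable_density.
have mp' : @measurable_fun _ _ (measurableTypeR R) (measurableTypeR R) setT p := mp.
rewrite -(@ge0_integral_pushforward _ _ (measurableTypeR R) (measurableTypeR R) _ p mp' leb A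
  (fun y => `|c|%:E * (`|y|^-1)%:E)%E mA md); last first.
  by move=> y _; rewrite mule_ge0.
rewrite ge0_integralZl//; last 1 first.
  exact: measurable_funS measurable_density.
have md' : measurable_fun A (fun t : measurableTypeR R => (`|t|^-1)%:E : \bar R).
  exact: measurable_funS measurable_density.
have /= <- // := @ge0_integral_mscale _ (measurableTypeR R) _
  (measure_function_pushforward__canonical__measure_function_Measure leb mp')
  A mA (NngNum (normr_ge0 c)) _ md'.
apply: eq_measure_integral => B mB BA /=.
by rewrite /mscale /= /pushforward lebesgue_scale.
Qed.

Lemma haar_singleton (a : R) : mu [set a] = 0%E.
Proof. exact: integral_set1. Qed.

(** Exhaustion by the annuli 1 / n <= |t| <= n, on which the density is bounded,
    and the null set {0}.  Product measures and Fubini's theorem rely on it. *)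
Lemma haar_sigma_finite : sigma_finite setT mu.
Proof.
pose F n := ([set 0 : R] `|` (`[- n.+1%:R, - n.+1%:R^-1] `|`
             `[n.+1%:R^-1, n.+1%:R]))%classic : set R.
exists F.
  apply/seteqP; split => // x _.
  have [->|x0] := eqVneq x 0; first by exists 0%N => //; left.
  pose m := (`|x| + `|x|^-1)%R.
  have mE : m < (Num.truncn m).+1%:R by exact: truncnS_gt.
  have hx : 0 < `|x| by rewrite normr_gt0.
  have xl : `|x| <= (Num.truncn m).+1%:R.
    by apply/ltW/(le_lt_trans _ mE); rewrite /m lerDl invr_ge0.
  have lx : (Num.truncn m).+1%:R^-1 <= `|x|.
    rewrite invf_ple ?posrE//; apply/ltW/(le_lt_trans _ mE).
    by rewrite /m lerDr.
  (* m exceeds both |x| and its inverse. *)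
  exists (Num.truncn m) => //; right.
  have [xp|xn|/esym/eqP] := ltgtP 0 x; last by rewrite (negbTE x0).
  - right; rewrite /= in_itv/=; rewrite gtr0_norm// in xl lx; exact/andP.
  - left; rewrite /= in_itv/=; rewrite ltr0_norm// in xl lx.
    by rewrite lerNl xl lerNr lx.
move=> n.
have mi : measurable (F n) by apply: measurableU => //; exact: measurableU.
split => //.
have n0 : 0 < n.+1%:R :> R by [].
have bnd a b : (forall x, x \in `[a, b] -> n.+1%:R^-1 <= `|x|) ->
    (mu `[a, b]%classic < +oo)%E.
  move=> H; rewrite /mu /=.
  apply: (@le_lt_trans _ _ (\int[leb]_(t in `[a, b]) (cst n.+1%:R%:E t))%E).
    apply: ge0_le_integral => //.
    - exact: measurable_funS measurable_density.
    - move=> x /H Hx; rewrite lee_fin invf_ple ?posrE//.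
      by rewrite (lt_le_trans _ Hx)// invr_gt0.
  rewrite integral_cst//= lebesgue_measure_itv/=.
  by case: ifP => _; rewrite -?EFinB -?EFinM ?mule0 ltry.
apply: (@le_lt_trans _ _ (mu [set 0%R] + (mu `[(- n.+1%:R)%R, (- n.+1%:R^-1)%R]%classic +
    mu `[(n.+1%:R^-1)%R, n.+1%:R]%classic))%E).
  apply: (le_trans (measureU2 _ _ _)) => //; first exact: measurableU.
  by rewrite leeD2l// measureU2.
rewrite [X in (X + _)%E]haar_singleton add0e lte_add_pinfty//; apply: bnd => x;
  rewrite in_itv/= => /andP[h1 h2].
- by rewrite ler0_norm; [rewrite lerNr|rewrite (le_trans h2)// oppr_le0 invr_ge0].
- by rewrite ger0_norm// (le_trans _ h1)// invr_ge0.
Qed.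

HB.instance Definition _ := Measure_isSigmaFinite.Build _ _ _ (@haar R)
  haar_sigma_finite.

Lemma haar_integral_scale (c : R) (f : R -> \bar R) : c != 0 ->
  measurable_fun setT f -> (forall t, 0 <= f t)%E ->
  (\int[mu]_t f (c * t)%R = \int[mu]_t f t)%E.
Proof.
move=> c0 mf f0.
have mp := measurable_scale c.
rewrite [LHS](_ : _ = \int[mu]_(t in ( *%R c) @^-1` setT) (f \o *%R c) t)%E//.
rewrite -(ge0_integral_pushforward mp)//.
by apply: eq_measure_integral => B mB _; exact: haar_scale.
Qed.

End haar_measure_theory.

(** * Complex-valued functions and their square norms *)

Section complex_squares.
Variable R : realType.
Implicit Types (z w : R[i]) (d : R).

(** The squared modulus.  As a polynomial in the real and imaginary parts it
    spares the square roots hidden in [normc]. *)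
Definition csq z : R := complex.Re z ^+ 2 + complex.Im z ^+ 2.

Lemma csq_ge0 z : 0 <= csq z.
Proof. by rewrite addr_ge0// sqr_ge0. Qed.

Lemma csqE z : csq z = normc z ^+ 2.
Proof. by case: z => a b; rewrite /csq /= sqr_sqrtr// addr_ge0// sqr_ge0. Qed.

Lemma normc_sqrt z : normc z = Num.sqrt (csq z).
Proof. by case: z. Qed.

Lemma csqM z w : csq (z * w) = csq z * csq w.
Proof. by case: z => a b; case: w => c e; rewrite /csq /=; ring. Qed.

Lemma csq_conj z : csq z^* = csq z.
Proof. by case: z => a b; rewrite /csq /= sqrrN. Qed.

Lemma csqN z : csq (- z) = csq z.
Proof. by case: z => a b; rewrite /csq /= !sqrrN. Qed.

Lemma csqD z w : csq (z + w) <= 2 * csq z + 2 * csq w.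
Proof.
case: z => a b; case: w => c e; rewrite /csq /= -subr_ge0.
rewrite [leRHS](_ : _ = (a - c) ^+ 2 + (b - e) ^+ 2); last by ring.
by rewrite addr_ge0// sqr_ge0.
Qed.

Lemma csq_cis (x : R) : csq (cis x) = 1.
Proof. by rewrite /csq /= addrC sin2cos2 subrK. Qed.

Lemma Re_le_normc z : `|complex.Re z| <= normc z.
Proof.
by rewrite normc_sqrt -sqrtr_sqr ler_wsqrtr// lerDl sqr_ge0.
Qed.

Lemma Im_le_normc z : `|complex.Im z| <= normc z.
Proof.
by rewrite normc_sqrt -sqrtr_sqr ler_wsqrtr// lerDr sqr_ge0.
Qed.

Lemma normc_le_ReIm z : normc z <= `|complex.Re z| + `|complex.Im z|.
Proof.
rewrite normc_sqrt -(@ler_pXn2r _ 2) ?nnegrE ?sqrtr_ge0 ?addr_ge0//.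
rewrite sqr_sqrtr ?csq_ge0// sqrrD !real_normK ?num_real//.
by rewrite /csq addrAC lerDl mulrn_wge0// mulr_ge0.
Qed.

Lemma normc_ge0 z : 0 <= normc z.
Proof. by rewrite normc_sqrt sqrtr_ge0. Qed.

Lemma normc_conj z : normc z^* = normc z.
Proof. by rewrite !normc_sqrt csq_conj. Qed.

(** A weighted arithmetic-geometric mean inequality.  The free weight d makes it
    a substitute for the Cauchy-Schwarz inequality when h is integrated. *)
Lemma amgm d (x y : R) : 0 < d -> x * y <= d * x ^+ 2 + d^-1 * y ^+ 2.
Proof.
move=> d0; have h : 0 <= d^-1 * (d * x - y / 2) ^+ 2 + d^-1 * (3 / 4) * y ^+ 2.
  by rewrite addr_ge0// mulr_ge0 ?sqr_ge0// ?mulr_ge0// ?invr_ge0 ?ltW//; lra.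
rewrite -subr_ge0; apply: le_trans h _; rewrite le_eqVlt; apply/orP; left.
by apply/eqP; field; rewrite gt_eqF.
Qed.

End complex_squares.

Section complex_measurable.
Context d (T : measurableType d) (R : realType).
Implicit Types f g : T -> R[i].

Definition cmeas f : Prop :=
  measurable_fun setT (fun t => complex.Re (f t)) /\
  measurable_fun setT (fun t => complex.Im (f t)).

Lemma cmeasD f g : cmeas f -> cmeas g -> cmeas (fun t => f t + g t).
Proof.
move=> [f1 f2] [g1 g2]; split.
  rewrite (_ : (fun t => _) = (fun t => complex.Re (f t) + complex.Re (g t))).
    exact: measurable_funD.
  by apply/funext => t; case: (f t) (g t) => ? ? [].
rewrite (_ : (fun t => _) = (fun t => complex.Im (f t) + complex.Im (g t))).
  exact: measurable_funD.
by apply/funext => t; case: (f t) (g t) => ? ? [].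
Qed.

Lemma cmeasM f g : cmeas f -> cmeas g -> cmeas (fun t => f t * g t).
Proof.
move=> [f1 f2] [g1 g2]; split.
  rewrite (_ : (fun t => _) = (fun t => complex.Re (f t) * complex.Re (g t)
    - complex.Im (f t) * complex.Im (g t))).
    by apply: measurable_funB; exact: measurable_funM.
  by apply/funext => t; case: (f t) (g t) => ? ? [].
rewrite (_ : (fun t => _) = (fun t => complex.Re (f t) * complex.Im (g t)
    + complex.Im (f t) * complex.Re (g t))).
  by apply: measurable_funD; exact: measurable_funM.
by apply/funext => t; case: (f t) (g t) => ? ? [].
Qed.

Lemma cmeas_conj f : cmeas f -> cmeas (fun t => (f t)^*).
Proof.
move=> [f1 f2]; split.
  rewrite (_ : (fun t => _) = (fun t => complex.Re (f t)))//.
  by apply/funext => t; case: (f t).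
rewrite (_ : (fun t => _) = (fun t => - complex.Im (f t)))//.
  exact: measurableT_comp.
by apply/funext => t; case: (f t).
Qed.

Lemma cmeas_cst (c : R[i]) : cmeas (fun=> c).
Proof. by []. Qed.

Lemma cmeasN f : cmeas f -> cmeas (fun t => - f t).
Proof.
move=> mf; rewrite (_ : (fun t => - f t) = (fun t => (- 1) * f t)).
  by apply: cmeasM => //; exact: cmeas_cst.
by apply/funext => t; rewrite mulN1r.
Qed.

Lemma cmeasB f g : cmeas f -> cmeas g -> cmeas (fun t => f t - g t).
Proof. by move=> mf mg; apply: cmeasD => //; exact: cmeasN. Qed.

Lemma measurable_csq f : cmeas f -> measurable_fun setT (fun t => csq (f t)).
Proof. by move=> [? ?]; apply: measurable_funD; exact: measurable_funX. Qed.

Lemma measurable_ecsq f : cmeas f ->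
  measurable_fun setT (fun t => (csq (f t))%:E : \bar R).
Proof. by move=> m; apply/measurable_EFinP; exact: measurable_csq. Qed.

Lemma measurable_normc f : cmeas f -> measurable_fun setT (fun t => normc (f t)).
Proof.
move=> mf; rewrite (_ : (fun t => _) = (fun t => csq (f t) `^ 2^-1)).
  by apply: (measurableT_comp (measurable_powR _)); exact: measurable_csq.
by apply/funext => t; rewrite normc_sqrt powR12_sqrt// csq_ge0.
Qed.

End complex_measurable.

Lemma cmeas_comp d d' (T : measurableType d) (T' : measurableType d')
    (R : realType) (f : T -> R[i]) (p : T' -> T) :
  cmeas f -> measurable_fun setT p -> cmeas (fun t => f (p t)).
Proof.
by move=> [f1 f2] mp; split; [apply: (measurableT_comp f1)|apply: (measurableT_comp f2)].
Qed.

Section square_norm.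
Variable R : realType.
Local Notation mu := (@haar R).
Implicit Types (xi eta : R -> R[i]).
Local Open Scope ereal_scope.

Definition sq xi : \bar R := \int[mu]_t (csq (xi t))%:E.

Lemma sq_ge0 xi : 0 <= sq xi.
Proof. by apply: integral_ge0 => t _; rewrite lee_fin csq_ge0. Qed.

Lemma L2normE xi : L2norm xi = sq xi `^ 2^-1.
Proof.
rewrite /L2norm unlock /sq; congr (_ `^ _); apply: eq_integral => t _ /=.
by rewrite ger0_norm ?normc_ge0// csqE powR_mulrn ?normc_ge0.
Qed.

Lemma L2norm_ge0 xi : 0 <= L2norm xi.
Proof. exact: Lnorm_ge0. Qed.

Lemma L2P xi : L2 xi <-> cmeas xi /\ sq xi < +oo.
Proof.
have h : (L2norm xi < +oo) = (sq xi < +oo).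
  rewrite L2normE; apply/idP/idP; last exact: poweR_lty.
  by apply: lty_poweRy; rewrite invr_neq0.
by split=> [[m1 m2]|[[m1 m2]]]; rewrite ?h// => ?; split; rewrite ?h.
Qed.

Lemma L2_cmeas xi : L2 xi -> cmeas xi. Proof. by move=> /L2P[]. Qed.
Lemma L2_sq xi : L2 xi -> sq xi < +oo. Proof. by move=> /L2P[]. Qed.

Lemma sq_fin xi : L2 xi -> sq xi \is a fin_num.
Proof. by move=> /L2_sq h; rewrite ge0_fin_numE// sq_ge0. Qed.

Lemma L2norm_fin xi : L2 xi -> L2norm xi \is a fin_num.
Proof. by case=> _ _ h; rewrite ge0_fin_numE// L2norm_ge0. Qed.

(** Products of norms are only ever bounded through sums of squares, which are
    integrals and so can themselves be integrated in a parameter. *)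
Lemma L2normM_le d xi eta : (0 < d)%R -> L2 xi -> L2 eta ->
  L2norm xi * L2norm eta <= d%:E * sq xi + d^-1%:E * sq eta.
Proof.
move=> d0 h1 h2; rewrite !L2normE.
have := sq_fin h1; have := sq_ge0 xi; case: (sq xi) => // x x0 _.
have := sq_fin h2; have := sq_ge0 eta; case: (sq eta) => // y y0 _.
rewrite !poweR_EFin -!EFinM -EFinD lee_fin !powR12_sqrt//.
by rewrite (le_trans (amgm _ _ d0))// !sqr_sqrtr.
Qed.

Lemma sqD xi eta : cmeas xi -> cmeas eta ->
  sq (xi + eta)%R <= 2%:E * sq xi + 2%:E * sq eta.
Proof.
move=> m1 m2; rewrite /sq -!ge0_integralZl//; try exact: measurable_ecsq;
  try by move=> *; rewrite lee_fin csq_ge0.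
rewrite -ge0_integralD//; try by move=> *; rewrite -EFinM lee_fin mulr_ge0// csq_ge0.
  2,3: by apply: measurable_funeM; exact: measurable_ecsq.
apply: ge0_le_integral => //; try by move=> *; rewrite lee_fin csq_ge0.
- by apply: measurable_ecsq; exact: cmeasD.
- by apply: emeasurable_funD; apply: measurable_funeM; exact: measurable_ecsq.
- by move=> t _; rewrite -!EFinM -EFinD lee_fin csqD.
Qed.

Lemma sqZ c xi : cmeas xi -> sq (c *: xi)%R = (csq c)%:E * sq xi.
Proof.
move=> m; rewrite /sq -ge0_integralZl ?lee_fin ?csq_ge0//.
- by apply: eq_integral => t _; rewrite -EFinM -csqM.
- exact: measurable_ecsq.
- by move=> *; rewrite lee_fin csq_ge0.
Qed.

Lemma sqN xi : sq (- xi)%R = sq xi.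
Proof. by apply: eq_integral => t _; rewrite -csqN opprK. Qed.

Lemma sq0 : sq (0 : R -> R[i])%R = 0.
Proof. by rewrite /sq; apply: integral0_eq => t _; rewrite /csq /= expr0n addr0. Qed.

Lemma L2D xi eta : L2 xi -> L2 eta -> L2 (xi + eta)%R.
Proof.
move=> /L2P[m1 h1] /L2P[m2 h2]; apply/L2P; split; first exact: cmeasD.
apply: (le_lt_trans (sqD m1 m2)).
by rewrite lte_add_pinfty// lte_mul_pinfty.
Qed.

Lemma L2Z c xi : L2 xi -> L2 (c *: xi)%R.
Proof.
move=> /L2P[m1 h1]; apply/L2P; split; first by apply: cmeasM => //; exact: cmeas_cst.
by rewrite sqZ// lte_mul_pinfty// lee_fin csq_ge0.
Qed.

Lemma L2N xi : L2 xi -> L2 (- xi)%R.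
Proof. by move=> /L2P[m h]; apply/L2P; rewrite sqN; split => //; exact: cmeasN. Qed.

Lemma L2B xi eta : L2 xi -> L2 eta -> L2 (xi - eta)%R.
Proof. by move=> h1 h2; apply: L2D => //; exact: L2N. Qed.

Lemma L20 : L2 (0 : R -> R[i])%R.
Proof. by apply/L2P; rewrite sq0; split. Qed.

End square_norm.

(** * Complex integrals and coefficients of the representation *)

Section complex_integral.
Variable R : realType.
Local Notation mu := (@haar R).
Implicit Types f g : R -> R[i].

Definition cintegrable f : Prop :=
  cmeas f /\ (\int[mu]_t (normc (f t))%:E < +oo)%E.

Lemma measurable_enormc f : cmeas f ->
  measurable_fun setT (fun t => (normc (f t))%:E : \bar R).
Proof. by move=> m; apply/measurable_EFinP; exact: measurable_normc. Qed.

Lemma cintegrable_Re f : cintegrable f ->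
  mu.-integrable setT (EFin \o (fun t => complex.Re (f t))).
Proof.
move=> [m h]; apply/integrableP; split; first by apply/measurable_EFinP; case: m.
apply: le_lt_trans h; apply: ge0_le_integral => //.
- by apply/measurable_EFinP; apply: measurableT_comp => //; case: m.
- exact: measurable_enormc.
- by move=> t _ /=; rewrite lee_fin Re_le_normc.
Qed.

Lemma cintegrable_Im f : cintegrable f ->
  mu.-integrable setT (EFin \o (fun t => complex.Im (f t))).
Proof.
move=> [m h]; apply/integrableP; split; first by apply/measurable_EFinP; case: m.
apply: le_lt_trans h; apply: ge0_le_integral => //.
- by apply/measurable_EFinP; apply: measurableT_comp => //; case: m.
- exact: measurable_enormc.
- by move=> t _ /=; rewrite lee_fin Im_le_normc.
Qed.

Lemma Cintegral_linear (c : R[i]) f g : cintegrable f -> cintegrable g ->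
  Cintegral (fun t => c * f t + g t) = c * Cintegral f + Cintegral g.
Proof.
move=> hf hg.
have [fr fi] := (cintegrable_Re hf, cintegrable_Im hf).
have [gr gi] := (cintegrable_Re hg, cintegrable_Im hg).
have s (k : R) u : mu.-integrable setT (EFin \o u) ->
    mu.-integrable setT (EFin \o (fun t => k * u t)).
  by move=> iu; apply: (integrableZl measurableT k iu).
have a u v : mu.-integrable setT (EFin \o u) -> mu.-integrable setT (EFin \o v) ->
    mu.-integrable setT (EFin \o (fun t => u t + v t)).
  by move=> iu iv; apply: (integrableD measurableT iu iv).
case: c => c d; rewrite /Cintegral /=.
have re (t : R) : complex.Re ((c +i* d) * f t + g t) =
    c * complex.Re (f t) + (- d) * complex.Im (f t) + complex.Re (g t).
  by case: (f t) => ? ?; case: (g t) => ? ? /=; rewrite mulNr.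
have im (t : R) : complex.Im ((c +i* d) * f t + g t) =
    c * complex.Im (f t) + d * complex.Re (f t) + complex.Im (g t).
  by case: (f t) => ? ?; case: (g t) => ? ? /=.
under eq_Rintegral do rewrite re.
under [X in _ +i* X = _]eq_Rintegral do rewrite im.
rewrite !RintegralD//; try by [apply: s|apply: a; exact: s].
rewrite !RintegralZl//.
by apply/eqP; rewrite eq_complex /= mulNr !eqxx.
Qed.

(** The constant 2, instead of the optimal 1, comes from treating the real
    and imaginary parts separately; it is harmless, since boundedness of a form
    and convergence to 0 allow any constant. *)
Lemma normc_Cintegral f : cintegrable f ->
  ((normc (Cintegral f))%:E <= 2%:E * \int[mu]_t (normc (f t))%:E)%E.
Proof.
move=> hf.
have [m h] := hf.
have fin : (\int[mu]_t (normc (f t))%:E)%E \is a fin_num.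
  by rewrite ge0_fin_numE// integral_ge0// => t _; rewrite lee_fin normc_ge0.
have key (u : R -> R) : mu.-integrable setT (EFin \o u) ->
    (forall t, `|u t| <= normc (f t)) ->
    `|Rintegral mu setT u| <= fine (\int[mu]_t (normc (f t))%:E)%E.
  move=> iu ule; apply: (le_trans (le_normr_Rintegral measurableT iu)).
  apply: fine_le => //.
    have /integrableP[mu' ] := iu; rewrite ge0_fin_numE//.
    by apply: integral_ge0 => t _.
  apply: ge0_le_integral => //.
  - apply/measurable_EFinP; apply: measurableT_comp => //.
    by apply/measurable_EFinP; exact: measurable_int iu.
  - exact: measurable_enormc.
  - by move=> t _; rewrite lee_fin.
rewrite -(fineK fin) -EFinM lee_fin (le_trans (normc_le_ReIm _))//= mulr2n mulrDl mul1r.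
by apply: lerD; apply: key => [|t];
  [exact: cintegrable_Re|exact: Re_le_normc|exact: cintegrable_Im|exact: Im_le_normc].
Qed.

(** Hoelder's inequality for the moduli, with both exponents equal to 2. *)
Lemma cauchy_schwarz f g : cmeas f -> cmeas g ->
  (\int[mu]_t (normc (f t * (g t)^*))%:E <= L2norm f * L2norm g)%E.
Proof.
move=> mf mg.
have := @hoelder _ _ _ mu (fun t => normc (f t)) (fun t => normc (g t)) 2 2
  (measurable_normc mf) (measurable_normc mg).
rewrite -/(L2norm f) -/(L2norm g) Lnorm1; move=> h.
apply: le_trans (h _ _ _) => //; last by lra.
rewrite le_eqVlt; apply/orP; left; apply/eqP; apply: eq_integral => t _ /=.
by rewrite normcM normc_conj ger0_norm// mulr_ge0 ?normc_ge0.
Qed.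

Lemma cintegrable_inner f g : L2 f -> L2 g ->
  cintegrable (fun t => f t * (g t)^*).
Proof.
move=> hf hg; have [mf mg] := (L2_cmeas hf, L2_cmeas hg).
split; first by apply: cmeasM => //; exact: cmeas_conj.
apply: (le_lt_trans (cauchy_schwarz mf mg)).
by rewrite -ge0_fin_numE ?mule_ge0 ?L2norm_ge0// fin_numM// L2norm_fin.
Qed.

End complex_integral.

Section representation_theory.
Variable R : realType.
Implicit Types (xi eta : R -> R[i]) (g : affine R).

Lemma cmeas_cis (c : R) : cmeas (fun t : R => cis (c * t)).
Proof.
split => /=.
- apply: (@measurableT_comp _ _ _ _ _ _ (@cos R)) => //.
  by apply: continuous_measurable_fun; exact: continuous_cos.
- apply: (@measurableT_comp _ _ _ _ _ _ (@sin R)) => //.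
  by apply: continuous_measurable_fun; exact: continuous_sin.
Qed.

Lemma cmeas_rep g xi : cmeas xi -> cmeas (rep g xi).
Proof.
move=> m; apply: cmeasM; first exact: cmeas_cis.
apply: (cmeas_comp m); exact: measurable_funM.
Qed.

(** Unitarity: characters have modulus one and the Haar measure is invariant. *)
Lemma sq_rep g xi : cmeas xi -> sq (rep g xi) = sq xi.
Proof.
move=> m; rewrite /sq.
rewrite -[RHS](@haar_integral_scale _ (dilation g)) ?dilation_neq0//.
- by apply: eq_integral => t _; rewrite csqM csq_cis mul1r mulrC.
- exact: measurable_ecsq.
- by move=> t; rewrite lee_fin csq_ge0.
Qed.

Lemma L2_rep g xi : L2 xi -> L2 (rep g xi).
Proof.
by move=> /L2P[m h]; apply/L2P; rewrite sq_rep//; split => //; exact: cmeas_rep.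
Qed.

Lemma normc_coef g xi eta : L2 xi -> L2 eta ->
  ((normc (coef xi eta g))%:E <= 2%:E * (L2norm xi * L2norm eta))%E.
Proof.
move=> h he; apply: (le_trans (normc_Cintegral _)).
  by apply: cintegrable_inner => //; exact: L2_rep.
rewrite lee_pmul2l//; apply: (le_trans (cauchy_schwarz _ _)).
- by apply: cmeas_rep; exact: L2_cmeas.
- exact: L2_cmeas.
- by rewrite !L2normE sq_rep//; exact: L2_cmeas.
Qed.

Lemma scale_addE (c : R[i]) xi eta t : (c *: xi + eta) t = c * xi t + eta t.
Proof. by []. Qed.

(** This makes evaluation at g a legitimate test form, so that the values of a
    coefficient series are computed by its tensor. *)
Lemma bounded_form_coef g : bounded_form (fun xi eta : R -> R[i] => coef xi eta g).
Proof.
split.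
- move=> c xi xi' eta h h' he.
  rewrite /coef /inner -Cintegral_linear; try by apply: cintegrable_inner => //; exact: L2_rep.
  congr Cintegral; apply/funext => t.
  by rewrite /rep scale_addE; ring.
- move=> c xi eta eta' h he he'.
  rewrite /coef /inner -Cintegral_linear; try by apply: cintegrable_inner => //; exact: L2_rep.
  congr Cintegral; apply/funext => t.
  rewrite scale_addE.
  have -> : (c * eta t + eta' t)^* = c^* * (eta t)^* + (eta' t)^*.
    by case: c (eta t) (eta' t) => ? ? [? ?] [? ?]; apply/eqP; rewrite eq_complex /=;
      apply/andP; split; apply/eqP; ring.
  ring.
- by exists 2 => xi eta h he; exact: normc_coef.
Qed.

End representation_theory.

(** * Absolutely convergent complex series and concatenated blocks *)

Section complex_limits.
Variable R : realType.

Lemma gt0_complexP (e : R[i]) : 0 < e -> exists2 e' : R, 0 < e' & e = e'%:C.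
Proof. by case: e => a b; rewrite ltcE /= => /andP[/eqP -> a0]; exists a. Qed.

Lemma cvg_normc (u : nat -> R[i]) (l : R[i]) :
  (fun n => normc (u n - l)) @ \oo --> (0 : R) ->
  ((u : nat -> R[i]^o) @ \oo --> (l : R[i]^o)).
Proof.
move=> h; apply/cvgrPdist_lt => e /gt0_complexP[e' e'0 ->].
have /cvgrPdist_lt /(_ _ e'0) := h; apply: filterS => n /=.
rewrite sub0r normrN ger0_norm ?normc_ge0// => lt.
by rewrite distrC /Num.norm /= ltcE /= eqxx.
Qed.

Lemma ler_normcD (z w : R[i]) : normc (z + w) <= normc z + normc w.
Proof. by have := ler_normD z w; rewrite /Num.norm /= lecE /= => /andP[_]. Qed.

Lemma normc_opp (z : R[i]) : normc (- z) = normc z.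
Proof. by rewrite !normc_sqrt csqN. Qed.

Lemma normc_cvg_uniq (u : nat -> R[i]) (l l' : R[i]) :
  (fun n => normc (u n - l)) @ \oo --> (0 : R) ->
  (fun n => normc (u n - l')) @ \oo --> (0 : R) -> l = l'.
Proof.
move=> h h'; apply/eqP; rewrite -subr_eq0; apply/eqP/eq0_normc/eqP.
rewrite eq_le normc_ge0 andbT.
have s : (fun n => normc (u n - l) + normc (u n - l')) @ \oo --> (0 : R).
  by rewrite -[X in _ --> X]addr0; exact: cvgD.
apply: (cvgr_to_ge s); apply: nearW => n.
rewrite (_ : l - l' = - (u n - l) + (u n - l')); last by ring.
by apply: (le_trans (ler_normcD _ _)); rewrite normc_opp.
Qed.

Lemma normc_sum (I : Type) (r : seq I) (F : I -> R[i]) :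
  normc (\sum_(i <- r) F i) <= \sum_(i <- r) normc (F i).
Proof.
elim/big_ind2 : _ => //; first by rewrite normc_sqrt /csq /= expr0n addr0 sqrtr0.
by move=> x y z w h1 h2; apply: (le_trans (ler_normcD _ _)); exact: lerD.
Qed.

(** Absolute convergence implies convergence, by completeness of the reals
    applied to the real and imaginary parts. *)
Lemma normc_series_cvg (a : nat -> R[i]) (w : nat -> R) :
  (forall k, normc (a k) <= w k) -> cvgn (series w) ->
  exists l : R[i], (fun n => normc (series a n - l)) @ \oo --> (0 : R).
Proof.
move=> aw cw.
have w0 k : 0 <= w k by exact: le_trans (normc_ge0 _) (aw k).
have cre : cvgn (series (fun k => complex.Re (a k))).
  apply: normed_cvg; apply: (series_le_cvg _ w0 _ cw) => k; rewrite ?normr_ge0//.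
  exact: le_trans (Re_le_normc _) (aw k).
have cim : cvgn (series (fun k => complex.Im (a k))).
  apply: normed_cvg; apply: (series_le_cvg _ w0 _ cw) => k; rewrite ?normr_ge0//.
  exact: le_trans (Im_le_normc _) (aw k).
exists (limn (series (fun k => complex.Re (a k))) +i* limn (series (fun k => complex.Im (a k)))).
have sE n : series a n = series (fun k => complex.Re (a k)) n +i*
     series (fun k => complex.Im (a k)) n.
  rewrite /series /=; elim/big_ind3 : _ => //.
    by move=> ? ? ? ? ? ? -> ->.
  by move=> i _; case: (a i).
have h : (fun n => `|series (fun k => complex.Re (a k)) n - limn (series (fun k => complex.Re (a k)))| +
  `|series (fun k => complex.Im (a k)) n - limn (series (fun k => complex.Im (a k)))|) @ \oo --> (0 : R).
  rewrite -[X in _ --> X]addr0; apply: cvgD.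
    rewrite -(normr0 R); apply: cvg_norm; rewrite -(subrr (limn (series (fun k => complex.Re (a k))))).
    by apply: cvgB => //; exact: cvg_cst.
  rewrite -(normr0 R); apply: cvg_norm; rewrite -(subrr (limn (series (fun k => complex.Im (a k))))).
  by apply: cvgB => //; exact: cvg_cst.
apply: (squeeze_cvgr _ (cvg_cst 0) h); apply: nearW => n.
by rewrite normc_ge0 /= sE; exact: normc_le_ReIm.
Qed.

End complex_limits.

Section concatenation.
Variables (T : Type) (d : T) (L : nat -> seq T).

(** Each block is preceded by a default entry, so that the first k + 1 blocks
    have more than k entries even when the given blocks are empty.  This is what
    makes [concat] total. *)
Definition blocks n : seq T := flatten (mkseq (fun m => d :: L m) n).

(** Later blocks do not change the entries already listed, so reading entry k
    in the first k + 1 blocks gives the same value as in any longer prefix. *)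
Definition concat k : T := nth d (blocks k.+1) k.

Lemma blocksS n : blocks n.+1 = blocks n ++ d :: L n.
Proof. by rewrite /blocks /mkseq -addn1 iotaD map_cat flatten_cat /= cats0. Qed.

Lemma size_blocks n : (n <= size (blocks n))%N.
Proof.
elim: n => // n IH; rewrite blocksS size_cat /= addnS ltnS.
exact: leq_trans IH (leq_addr _ _).
Qed.

Lemma nth_blocks n m k : (n <= m)%N -> (k < size (blocks n))%N ->
  nth d (blocks m) k = nth d (blocks n) k.
Proof.
move=> /subnKC <-; elim: (m - n)%N => [|j IH] kn; first by rewrite addn0.
rewrite addnS blocksS nth_cat IH//; case: ltnP => // h.
suff : (size (blocks n) <= size (blocks (n + j)))%N by move/(leq_trans kn); rewrite ltnNge h.
elim: j {IH h} => [|j IH]; first by rewrite addn0.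
by rewrite addnS blocksS size_cat (leq_trans IH)// leq_addr.
Qed.

Lemma concatE n k : (k < size (blocks n))%N -> concat k = nth d (blocks n) k.
Proof.
move=> kn; rewrite /concat; case: (leqP n k.+1) => h; first exact: nth_blocks.
by apply/esym/nth_blocks; [exact: ltnW|exact: size_blocks].
Qed.

(** Partial sums that stop at the end of a block are sums of whole blocks; the
    default entries must not contribute. *)
Lemma sum_concat (V : nmodType) (f : T -> V) n : f d = 0 ->
  \sum_(k < size (blocks n)) f (concat k) = \sum_(m < n) \sum_(p <- L m) f p.
Proof.
move=> fd; transitivity (\sum_(p <- blocks n) f p).
  rewrite (big_nth d) big_mkord; apply: eq_bigr => k _.
  by rewrite (@concatE n).
elim: n => [|n IH]; first by rewrite /blocks /= big_nil big_ord0.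
by rewrite blocksS big_cat /= IH big_ord_recr /= big_cons fd add0r.
Qed.

End concatenation.

(** * The coefficient space is complete *)

Section tensor_blocks.
Variable R : realType.
Local Notation vec := (R -> R[i]).
Implicit Types (p : vec * vec) (l : seq (vec * vec)).

(** What an elementary tensor contributes to the projective norm. *)
Definition weight p : \bar R := (L2norm p.1 * L2norm p.2)%E.

Definition L2pair p : Prop := L2 p.1 /\ L2 p.2.

Definition tensor_coef l : affine R -> R[i] := \sum_(p <- l) coef p.1 p.2.

Lemma tensor_coefE l g : tensor_coef l g = \sum_(p <- l) coef p.1 p.2 g.
Proof. by rewrite /tensor_coef fct_sumE. Qed.

Lemma weight_ge0 p : (0 <= weight p)%E.
Proof. by rewrite mule_ge0// L2norm_ge0. Qed.

Definition pair0 : vec * vec := (0, 0).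

Lemma weight0 : weight pair0 = 0%E.
Proof. by rewrite /weight /= !L2normE sq0 poweR0r ?mul0e// invr_neq0. Qed.

Lemma form00 (B : Defs.form R) : bounded_form B -> B 0 0 = 0.
Proof.
move=> [/(_ (-1) 0 0 0 (@L20 R) (@L20 R) (@L20 R)) + _ _].
by rewrite scaler0 addr0 mulN1r addNr.
Qed.

Variable L : nat -> seq (vec * vec).
Hypothesis L2L : forall m p, p \in L m -> L2pair p.

Local Notation tensors := (concat pair0 L).

Lemma L2pair_concat k : L2pair (tensors k).
Proof.
have : forall n p, p \in blocks pair0 L n -> L2pair p.
  elim=> [|n IH] p; first by rewrite /blocks in_nil.
  rewrite blocksS mem_cat inE => /orP[/IH//|/orP[/eqP ->|/L2L//]].
  by split; exact: L20.
by apply; rewrite /concat; apply: mem_nth; exact: size_blocks.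
Qed.

Lemma tensor_weight_concat :
  (tensor_weight (fun k => (tensors k).1) (fun k => (tensors k).2) <=
   \sum_(0 <= m <oo) \sum_(p <- L m) weight p)%E.
Proof.
apply: lime_le; first by apply: is_cvg_nneseries => n _ _; exact: weight_ge0.
apply: nearW => n.
apply: (@le_trans _ _ (\sum_(k < size (blocks pair0 L n)) weight (tensors k))%E).
  rewrite -(big_mkord xpredT (fun k => weight (tensors k))).
  rewrite [leRHS](big_cat_nat (leq0n n) (size_blocks pair0 L n)) /= leeDl//.
  by apply: sume_ge0 => k _; exact: weight_ge0.
rewrite (@sum_concat _ _ L (\bar R) weight n weight0).
rewrite -(big_mkord xpredT (fun m => \sum_(p <- L m) weight p)%E).
apply: nneseries_lim_ge => m _ _.
by apply: sume_ge0 => p _; exact: weight_ge0.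
Qed.

Hypothesis fin_weight : (\sum_(0 <= m <oo) \sum_(p <- L m) weight p < +oo)%E.

(** A bounded form is summable along tensors of finite total weight, hence its
    series converges.  Its limit is found along the subsequence of block ends. *)
Lemma concat_tensor_series : exists x,
  tensor_series x (fun k => (tensors k).1) (fun k => (tensors k).2) /\
  forall B, bounded_form B ->
    (fun n => normc (\sum_(m < n) \sum_(p <- L m) B p.1 p.2 - x B))
      @ \oo --> (0 : R).
Proof.
have fw := le_lt_trans tensor_weight_concat fin_weight.
have wfin k : weight (tensors k) \is a fin_num.
  by have [h1 h2] := L2pair_concat k; rewrite fin_numM// L2norm_fin.
have cw : cvgn (series (fun k => fine (weight (tensors k)))).
  apply: nnseries_is_cvg => [k|]; first by rewrite fine_ge0// weight_ge0.
  by under eq_eseriesr do rewrite fineK//.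
have ex (B : Defs.form R) : bounded_form B -> exists l : R[i],
    (fun n => normc (series (fun k => B (tensors k).1 (tensors k).2) n - l)) @ \oo --> (0 : R).
  move=> [_ _ [M BM]].
  apply: (@normc_series_cvg _ _ (fun k => M * fine (weight (tensors k)))) => [k|].
    have [h1 h2] := L2pair_concat k; have := BM _ _ h1 h2.
    by rewrite -[(_ * L2norm _)%E](fineK (wfin k)) -EFinM lee_fin.
  have H : cvgn (series (M *: (fun k => fine (weight (tensors k))))).
    exact: is_cvg_seriesZ.
  exact: H.
have [x xP] : exists x : Defs.form R -> R[i], forall B, bounded_form B ->
    (fun n => normc (series (fun k => B (tensors k).1 (tensors k).2) n - x B)) @ \oo --> (0 : R).
  have h (B : Defs.form R) : exists l : R[i], bounded_form B ->
    (fun n => normc (series (fun k => B (tensors k).1 (tensors k).2) n - l)) @ \oo --> (0 : R).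
    by have [/ex[l lP]|nB] := pselect (bounded_form B); [exists l|exists 0].
  by have [x xP] := choice h; exists x.
exists x; split.
  split => //; [by move=> k; case: (L2pair_concat k)|by move=> k; case: (L2pair_concat k)|].
  by move=> B /xP; exact: cvg_normc.
move=> B bB.
have sub : (fun n => size (blocks pair0 L n)) @ \oo --> \oo.
  apply/cvgnyPge => A; exists A => // n /= An.
  exact: leq_trans An (size_blocks _ _ _).
have := cvg_comp _ _ sub (xP B bB); apply: cvg_trans; apply: near_eq_cvg.
apply: nearW => n /=.
by rewrite /series /= big_mkord (@sum_concat _ pair0 L R[i] (fun p => B p.1 p.2) n (form00 bB)).
Qed.

(** The coefficient space is complete, and more is true: a merely pointwise
    convergent series of coefficients whose tensors have finite total weight
    converges in norm, its sum being the image of the concatenated tensors. *)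
Lemma Api_series (u : affine R -> R[i]) :
  (forall g, (fun n => normc (\sum_(m < n) tensor_coef (L m) g - u g)) @ \oo --> (0 : R)) ->
  Api u /\ (Api_norm u <= \sum_(0 <= m <oo) \sum_(p <- L m) weight p)%E.
Proof.
move=> hu; have [x [xs xP]] := concat_tensor_series.
have xu : Psi x = u.
  apply/funext => g; apply: normc_cvg_uniq (xP _ (bounded_form_coef g)) _.
  have := hu g; by under eq_fun do under eq_bigr do rewrite tensor_coefE.
have px : projective_tensor x by do 2 eexists; exact: xs.
split; first by exists x.
apply: (@le_trans _ _ (projective_norm x)).
  by apply: ereal_inf_lbound; exists x.
apply: le_trans tensor_weight_concat; apply: ereal_inf_lbound.
by do 2 eexists; split; first exact: xs.
Qed.

End tensor_blocks.

Lemma Api_finite (R : realType) (l : seq ((R -> R[i]) * (R -> R[i]))) :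
  (forall p, p \in l -> L2pair p) ->
  Api (tensor_coef l) /\ (Api_norm (tensor_coef l) <= \sum_(p <- l) weight p)%E.
Proof.
move=> hl; pose L m := if m is 0%N then l else [::].
have wE : (\sum_(0 <= m <oo) \sum_(p <- L m) weight p = \sum_(p <- l) weight p)%E.
  rewrite nneseries_recl //; last by move=> m _; apply: sume_ge0 => p _; exact: weight_ge0.
  rewrite eseries0 ?adde0// => -[]// m _ _; by rewrite /L big_nil.
rewrite -wE; apply: Api_series.
- by case => //= p.
- rewrite wE big_seq; apply: (big_ind (fun x => x < +oo)%E) => //.
    by move=> x y; exact: lte_add_pinfty.
  by move=> p /hl[h1 h2]; rewrite -ge0_fin_numE ?weight_ge0// fin_numM// L2norm_fin.
- move=> g; apply: (cvg_near_cst 0); exists 1%N => // n /= n0.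
  rewrite -(big_mkord xpredT (fun m => tensor_coef (L m) g)) big_ltn//=.
  rewrite big_nat big1 ?addr0 ?subrr ?normc_sqrt /csq /= ?expr0n ?addr0 ?sqrtr0//.
  by move=> -[|m] //= _; rewrite tensor_coefE big_nil.
Qed.

(** * Differences of coefficients *)

Section coefficient_differences.
Variable R : realType.
Local Notation vec := (R -> R[i]).
Implicit Types (f k : vec) (p : vec * vec) (l : seq (vec * vec)) (d : R).

Lemma coefBl f f' k : L2 f -> L2 f' -> L2 k ->
  coef (f - f') k = coef f k - coef f' k.
Proof.
move=> h h' hk; apply/funext => g; have [lin _ _] := bounded_form_coef g.
have := lin (-1) f' f k h' h hk.
by rewrite scaleN1r addrC => ->; rewrite mulN1r addrC.
Qed.

Lemma coefBr f k k' : L2 f -> L2 k -> L2 k' ->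
  coef f (k - k') = coef f k - coef f k'.
Proof.
move=> hf h h'; apply/funext => g; have [_ lin _] := bounded_form_coef g.
have := lin (-1) f k' k hf h' h.
rewrite scaleN1r addrC => ->; rewrite rmorphN rmorph1 mulN1r addrC//.
Qed.

Lemma coef0l k : L2 k -> coef (0 : vec) k = 0.
Proof.
move=> hk; have := coefBl (@L20 R) (@L20 R) hk.
by rewrite subrr => ->; rewrite subrr.
Qed.

Lemma coefNl f k : L2 f -> L2 k -> coef (- f) k = - coef f k.
Proof.
move=> hf hk; have := coefBl (@L20 R) hf hk.
by rewrite sub0r coef0l// sub0r.
Qed.

(** With d = f - f' and e = k - k', the identity
    f (x) k - f' (x) k' = d (x) k + f (x) e - d (x) e.  Each term contains a
    difference, and f' and k' occur only through d and e. *)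
Definition diff_tensors f k f' k' : seq (vec * vec) :=
  [:: (f - f', k); (f, k - k'); (- (f - f'), k - k')].

(** The arithmetic-geometric mean bound for the weight of [diff_tensors].  When
    the differences have squared norm of order d ^ 2, it is of order d. *)
Definition diff_bound d f k f' k' : \bar R :=
  (d%:E * (sq f + sq k) + (2 / d)%:E * (sq (f - f')%R + sq (k - k')%R))%E.

Lemma L2_diff_tensors f k f' k' p : L2 f -> L2 k -> L2 f' -> L2 k' ->
  p \in diff_tensors f k f' k' -> L2pair p.
Proof.
move=> hf hk hf' hk'; rewrite !inE => /or3P[] /eqP ->; split => //=;
  by [exact: L2B|apply: L2N; exact: L2B].
Qed.

Lemma coef_diff_tensors f k f' k' : L2 f -> L2 k -> L2 f' -> L2 k' ->
  tensor_coef (diff_tensors f k f' k') = coef f k - coef f' k'.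
Proof.
move=> hf hk hf' hk'; rewrite /tensor_coef !big_cons big_nil /= addr0.
have [hd he] := (L2B hf hf', L2B hk hk').
by rewrite coefNl// !coefBl// !coefBr//; ring.
Qed.

Lemma weight_diff_tensors d f k f' k' : 0 < d -> d <= 1 ->
  L2 f -> L2 k -> L2 f' -> L2 k' ->
  (\sum_(p <- diff_tensors f k f' k') weight p <= diff_bound d f k f' k')%E.
Proof.
move=> d0 d1 hf hk hf' hk'; rewrite !big_cons big_nil /= adde0 /weight /=.
have [hd he] := (L2B hf hf', L2B hk hk').
have di0 : 0 < d^-1 by rewrite invr_gt0.
have h1 := L2normM_le di0 hd hk.
have h2 := L2normM_le d0 hf he.
have h3 := L2normM_le ltr01 (L2N hd) he.
apply: (le_trans (leeD h1 (leeD h2 h3))).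
rewrite /diff_bound sqN invrK invr1 !mul1e.
have := sq_fin hf; have := sq_ge0 f; case: (sq f) => // sf sf0 _.
have := sq_fin hk; have := sq_ge0 k; case: (sq k) => // sk sk0 _.
have := sq_fin hd; have := sq_ge0 (f - f'); case: (sq (f - f')) => // sd sd0 _.
have := sq_fin he; have := sq_ge0 (k - k'); case: (sq (k - k')) => // se se0 _.
suff : d^-1 * sd + d * sk + (d * sf + d^-1 * se + (sd + se)) <=
    d * (sf + sk) + 2 / d * (sd + se) by rewrite -lee_fin.
move: sf0 sk0 sd0 se0; rewrite !lee_fin => sf0 sk0 sd0 se0.
have di1 : 1 <= d^-1 by rewrite invf_ge1.
by move: (d^-1) di0 di1 => e e0 e1; nra.
Qed.

(** Since the bound is infinite as soon as one of the vectors is not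
    square-integrable, the estimates below need no exceptional null set. *)
Lemma diff_bound_L2 d f k f' k' : 0 < d -> cmeas f -> cmeas k ->
  (diff_bound d f k f' k' < +oo)%E -> L2 f /\ L2 k.
Proof.
move=> d0 mf mk fin.
have d2 : 0 <= 2 / d by rewrite divr_ge0// ltW.
have : (sq f + sq k < +oo)%E.
  rewrite ltNge leye_eq; apply/negP => /eqP E; move: fin.
  rewrite /diff_bound E gt0_muley ?lte_fin// addye// -ltNye.
  by apply: lt_le_trans (_ : 0 <= _)%E => //; rewrite mule_ge0// adde_ge0// sq_ge0.
by move=> s; split; apply/L2P; split => //; apply: le_lt_trans s;
  rewrite ?leeDl ?leeDr ?sq_ge0.
Qed.

Lemma Api_norm_diff d f k f' k' : 0 < d -> d <= 1 ->
  cmeas f -> cmeas k -> L2 f' -> L2 k' ->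
  (Api_norm (coef f k - coef f' k')%R <= diff_bound d f k f' k')%E.
Proof.
move=> d0 d1 mf mk hf' hk'.
have [fin|] := ltP (diff_bound d f k f' k') +oo%E; last by apply: le_trans; rewrite leey.
have [hf hk] := diff_bound_L2 d0 mf mk fin.
rewrite -coef_diff_tensors//.
apply: le_trans (weight_diff_tensors d0 d1 hf hk hf' hk').
apply: (Api_finite _).2 => p; exact: L2_diff_tensors.
Qed.

Lemma normc_tensor_coef g l : (forall p, p \in l -> L2pair p) ->
  ((normc (tensor_coef l g))%:E <= 2%:E * \sum_(p <- l) weight p)%E.
Proof.
move=> hl; rewrite tensor_coefE.
apply: (@le_trans _ _ (\sum_(p <- l) (normc (coef p.1 p.2 g))%:E)%E).
  by rewrite sumEFin lee_fin normc_sum.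
rewrite ge0_sume_distrr; last by move=> p _; exact: weight_ge0.
rewrite !big_seq; apply: lee_sum => p /hl[h1 h2]; exact: normc_coef.
Qed.

Lemma normc_coef_diff g d f k f' k' : 0 < d -> d <= 1 ->
  cmeas f -> cmeas k -> L2 f' -> L2 k' ->
  ((normc (coef f k g - coef f' k' g)%R)%:E <= 2%:E * diff_bound d f k f' k')%E.
Proof.
move=> d0 d1 mf mk hf' hk'.
have [fin|] := ltP (diff_bound d f k f' k') +oo%E; last first.
  by rewrite leye_eq => /eqP ->; rewrite gt0_muley ?leey.
have [hf hk] := diff_bound_L2 d0 mf mk fin.
have -> : coef f k g - coef f' k' g = tensor_coef (diff_tensors f k f' k') g.
  by rewrite coef_diff_tensors.
apply: (le_trans (normc_tensor_coef _ _)); first by move=> p; exact: L2_diff_tensors.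
by rewrite lee_pmul2l// weight_diff_tensors.
Qed.

Definition scale_tensor (c : R) p : vec * vec := (c%:C *: p.1, p.2).

Lemma L2_scale_tensor c p : L2pair p -> L2pair (scale_tensor c p).
Proof. by move=> [h1 h2]; split => //; exact: L2Z. Qed.

Lemma weight_scale_tensor c p : 0 <= c -> L2pair p ->
  weight (scale_tensor c p) = (c%:E * weight p)%E.
Proof.
move=> c0 [h1 h2]; rewrite /weight /= muleA; congr (_ * _)%E.
rewrite !L2normE sqZ; last exact: L2_cmeas.
rewrite poweRM ?lee_fin ?csq_ge0 ?sq_ge0//; congr (_ * _)%E.
by rewrite /csq /= expr0n addr0 powR12_sqrt ?sqr_ge0// sqrtr_sqr ger0_norm.
Qed.

Lemma coef_scale_tensor c p g : L2pair p ->
  coef (scale_tensor c p).1 (scale_tensor c p).2 g = c%:C * coef p.1 p.2 g.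
Proof.
move=> [h1 h2] /=; have [lin _ _] := bounded_form_coef g.
have := lin c%:C p.1 0 p.2 h1 (@L20 R) h2.
by rewrite addr0 => ->; rewrite coef0l// addr0.
Qed.

End coefficient_differences.

(** * Step functions are dense in the square-integrable functions on a product *)

Lemma maxrBN (R : realDomainType) (x : R) : Num.max x 0 - Num.max (- x) 0 = x.
Proof.
case: (leP x 0) => h; first by rewrite max_l ?oppr_ge0// opprK add0r.
by rewrite max_r ?oppr_le0 ?ltW// subr0.
Qed.

Section step_approximation.
Context d1 d2 (T1 : measurableType d1) (T2 : measurableType d2) (R : realType).
Variable m1 : {sigma_finite_measure set T1 -> \bar R}.
Variable m2 : {sigma_finite_measure set T2 -> \bar R}.
Local Notation m := (m1 \x m2)%E.
Implicit Types (G : T1 * T2 -> R).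

(** The simple functions of the Bochner space L^2(T1; L^2(T2)): a value other
    than 0 is taken on a set of finite measure. *)
Definition step_field (I : finType) (e : T1 -> I) (phi : I -> T2 -> R) : Prop :=
  [/\ forall i, measurable (e @^-1` [set i]),
      forall i, measurable_fun setT (phi i),
      forall i, (\int[m2]_y (phi i y ^+ 2)%:E < +oo)%E &
      forall i, (m1 (e @^-1` [set i]) < +oo)%E \/ phi i = (fun=> 0)].

Definition field_fun (I : finType) (e : T1 -> I) (phi : I -> T2 -> R)
  (z : T1 * T2) : R := phi (e z.1) z.2.

Definition sqdist G G' : \bar R := (\int[m]_z ((G z - G' z) ^+ 2)%:E)%E.

(** Membership in the closure of the step fields for the square mean. *)
Definition approximable G : Prop := measurable_fun setT G /\
  forall eps : R, 0 < eps -> exists (I : finType) (e : T1 -> I) (phi : I -> T2 -> R),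
    step_field e phi /\ (sqdist G (field_fun e phi) <= eps%:E)%E.

Lemma measurable_cells d (T : measurableType d) (I : finType) (e : T1 -> I)
    (F : I -> T1 * T -> R) :
  (forall i, measurable (e @^-1` [set i])) ->
  (forall i, measurable_fun setT (F i)) ->
  measurable_fun setT (fun z => F (e z.1) z).
Proof.
move=> me mF.
rewrite (_ : (fun z => _) = (fun z => \sum_(i : I) \1_(e @^-1` [set i]) z.1 * F i z)).
  apply: measurable_sum => i; apply: measurable_funM => //.
  apply: (@measurableT_comp _ _ _ _ _ _ (\1_(e @^-1` [set i]) : T1 -> R)) => //.
apply/funext => z; rewrite (bigD1 (e z.1))//= indicE mem_set// mul1r big1 ?addr0// => i ie.
by rewrite indicE memNset ?mul0r//= => ei; rewrite ei eqxx in ie.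
Qed.

Lemma measurable_field (I : finType) (e : T1 -> I) (phi : I -> T2 -> R) :
  step_field e phi -> measurable_fun setT (field_fun e phi).
Proof.
move=> [me mphi _ _]; apply: (@measurable_cells _ _ _ _ (fun i z => phi i z.2)) => // i.
exact: measurableT_comp.
Qed.

Lemma measurable_esqr d (T : measurableType d) (f : T -> R) : measurable_fun setT f ->
  measurable_fun setT (fun z => (f z ^+ 2)%:E).
Proof. by move=> mf; apply/measurable_EFinP; exact: measurable_funX. Qed.

(** A substitute for Minkowski's inequality that avoids square roots. *)
Lemma integral_sqrD d (T : measurableType d) (mu : {measure set T -> \bar R})
    (f g : T -> R) : measurable_fun setT f -> measurable_fun setT g ->
  (\int[mu]_z ((f z + g z) ^+ 2)%:E <=
   2%:E * \int[mu]_z (f z ^+ 2)%:E + 2%:E * \int[mu]_z (g z ^+ 2)%:E)%E.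
Proof.
move=> mf mg.
have pos (h : T -> R) (z : T) : setT z -> (0 <= (h z ^+ 2)%:E)%E by rewrite lee_fin sqr_ge0.
rewrite -!ge0_integralZl//; try exact: measurable_esqr; try exact: pos.
rewrite -ge0_integralD//; try by move=> z _; rewrite mule_ge0// lee_fin sqr_ge0.
  2,3: by apply: measurable_funeM; exact: measurable_esqr.
apply: ge0_le_integral => //.
- by move=> z _; rewrite lee_fin sqr_ge0.
- by apply: measurable_esqr; exact: measurable_funD.
- by apply: emeasurable_funD; apply: measurable_funeM; exact: measurable_esqr.
- move=> z _; rewrite -!EFinM -EFinD lee_fin -subr_ge0.
  by rewrite [leRHS](_ : _ = (f z - g z) ^+ 2) ?sqr_ge0//; ring.
Qed.

Lemma integral_sqrZ d (T : measurableType d) (mu : {measure set T -> \bar R})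
    (c : R) (f : T -> R) : measurable_fun setT f ->
  (\int[mu]_z ((c * f z) ^+ 2)%:E = (c ^+ 2)%:E * \int[mu]_z (f z ^+ 2)%:E)%E.
Proof.
move=> mf; rewrite -ge0_integralZl//.
- by apply: eq_integral => z _; rewrite -EFinM exprMn.
- exact: measurable_esqr.
- by move=> z _; rewrite lee_fin sqr_ge0.
- by rewrite lee_fin sqr_ge0.
Qed.

Lemma sqdist_split G G' f g eps : (forall z, G z - G' z = f z + g z) ->
  measurable_fun setT f -> measurable_fun setT g ->
  (\int[m]_z (f z ^+ 2)%:E <= (eps / 4)%:E)%E ->
  (\int[m]_z (g z ^+ 2)%:E <= (eps / 4)%:E)%E -> (sqdist G G' <= eps%:E)%E.
Proof.
move=> E mf mg hf hg.
rewrite (_ : sqdist _ _ = \int[m]_z ((f z + g z) ^+ 2)%:E)%E; last first.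
  by apply: eq_integral => z _; rewrite E.
apply: (le_trans (integral_sqrD _ mf mg)).
apply: (@le_trans _ _ (2%:E * (eps / 4)%:E + 2%:E * (eps / 4)%:E)%E).
  by apply: leeD; rewrite lee_pmul2l.
by rewrite -!EFinM -EFinD lee_fin le_eqVlt; apply/orP; left; apply/eqP; field.
Qed.

Lemma approximable_limit G : measurable_fun setT G ->
  (forall eps : R, 0 < eps -> exists2 G', approximable G' & (sqdist G G' <= eps%:E)%E) ->
  approximable G.
Proof.
move=> mG h; split => // eps eps0.
have e40 : 0 < eps / 4 by rewrite divr_gt0.
have [G' [mG' aG'] GG'] := h _ e40.
have [I [e [phi [sf G'f]]]] := aG' _ e40.
exists I, e, phi; split => //.
have mf := measurable_field sf.
apply: (@sqdist_split _ _ (fun z => G z - G' z) (fun z => G' z - field_fun e phi z)) => //.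
- by move=> z; ring.
- exact: measurable_funB.
- exact: measurable_funB.
Qed.

(** On a common refinement of the two partitions, indexed by pairs. *)
Lemma approximableD G G' : approximable G -> approximable G' ->
  approximable (fun z => G z + G' z).
Proof.
move=> [mG aG] [mG' aG']; split; first exact: measurable_funD.
move=> eps eps0; have e40 : 0 < eps / 4 by rewrite divr_gt0.
have [I [e [phi [sf Gf]]]] := aG _ e40.
have [J [e' [phi' [sf' Gf']]]] := aG' _ e40.
exists (I * J)%type, (fun x => (e x, e' x)), (fun i y => phi i.1 y + phi' i.2 y); split.
  have [me mp ip fp] := sf; have [me' mp' ip' fp'] := sf'.
  have cE i : (fun x => (e x, e' x)) @^-1` [set i] =
      e @^-1` [set i.1] `&` e' @^-1` [set i.2].
    by case: i => i j; apply/seteqP; split => x /= [-> ->].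
  split.
  - by move=> i; rewrite cE; exact: measurableI.
  - by move=> i; exact: measurable_funD.
  - move=> i; apply: (le_lt_trans (integral_sqrD _ (mp _) (mp' _))).
    by rewrite lte_add_pinfty// lte_mul_pinfty.
  - move=> i; rewrite cE; case: (fp i.1) => [f|->].
      left; apply: le_lt_trans f; apply: le_measure; rewrite ?inE//.
      exact: measurableI.
    case: (fp' i.2) => [f|->]; last by right; apply/funext => y; rewrite addr0.
    left; apply: le_lt_trans f; apply: le_measure; rewrite ?inE//.
    exact: measurableI.
have mf := measurable_field sf; have mf' := measurable_field sf'.
apply: (@sqdist_split _ _ (fun z => G z - field_fun e phi z)
  (fun z => G' z - field_fun e' phi' z)) => //.
- by move=> z; rewrite /field_fun /=; ring.
- exact: measurable_funB.
- exact: measurable_funB.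
Qed.

Lemma approximableZ c G : approximable G -> approximable (fun z => c * G z).
Proof.
move=> [mG aG]; split; first exact: measurable_funM.
move=> eps eps0; have c0 : 0 < c ^+ 2 + 1 by rewrite ltr_wpDl// sqr_ge0.
have e0 : 0 < eps / (c ^+ 2 + 1) by rewrite divr_gt0.
have [I [e [phi [sf Gf]]]] := aG _ e0.
have [me mp ip fp] := sf.
exists I, e, (fun i y => c * phi i y); split.
  split => //.
  - by move=> i; exact: measurable_funM.
  - by move=> i; rewrite integral_sqrZ// lte_mul_pinfty// lee_fin sqr_ge0.
  - move=> i; case: (fp i) => [|->]; first by left.
    by right; apply/funext => y; rewrite mulr0.
rewrite (_ : sqdist _ _ = \int[m]_z ((c * (G z - field_fun e phi z)) ^+ 2)%:E)%E;
  last by apply: eq_integral => z _; rewrite mulrBr.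
rewrite integral_sqrZ; last by apply: measurable_funB => //; exact: measurable_field.
apply: (@le_trans _ _ ((c ^+ 2)%:E * (eps / (c ^+ 2 + 1))%:E)%E).
  by rewrite lee_wpmul2l// lee_fin sqr_ge0.
rewrite -EFinM lee_fin mulrA ler_pdivrMr// mulrC ler_pM2l//.
by rewrite lerDl.
Qed.

Lemma approximable0 : approximable (fun=> 0).
Proof.
split => // eps eps0; exists unit, (fun=> tt), (fun _ _ => 0); split.
  split=> //; last by right.
    by move=> i; rewrite (_ : _ @^-1` _ = setT)//; apply/seteqP; split => // x _ /=; case: i.
  by move=> i; rewrite integral0_eq// => y _; rewrite expr0n.
by rewrite /sqdist integral0_eq ?lee_fin ?ltW// => y _; rewrite /field_fun subrr expr0n.
Qed.

Lemma approximable_sum (J : Type) (r : seq J) (G : J -> T1 * T2 -> R) :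
  (forall j, approximable (G j)) -> approximable (fun z => \sum_(j <- r) G j z).
Proof.
move=> aG; elim: r => [|j r IH].
  by under eq_fun do rewrite big_nil; exact: approximable0.
by under eq_fun do rewrite big_cons; exact: approximableD.
Qed.

(** The closure is stable under dominated pointwise limits; this serves
    both for countable unions of sets and for limits of simple functions. *)
Lemma approximable_dominated (G : T1 * T2 -> R) (Gn : nat -> T1 * T2 -> R)
    (H : T1 * T2 -> R) :
  measurable_fun setT G -> (forall n, approximable (Gn n)) ->
  (forall z, Gn ^~ z @ \oo --> G z) ->
  m.-integrable setT (EFin \o H) ->
  (forall n z, (G z - Gn n z) ^+ 2 <= H z) ->
  approximable G.
Proof.
move=> mG aG cG iH GH; apply: approximable_limit => // eps eps0.
have mD n : measurable_fun setT (fun z => ((G z - Gn n z) ^+ 2)%:E).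
  by apply: measurable_esqr; apply: measurable_funB => //; case: (aG n).
have [||||_ _] := @dominated_convergence _ _ _ m setT measurableT
  (fun n z => ((G z - Gn n z) ^+ 2)%:E) (cst 0%E) (EFin \o H) mD.
- exact: measurable_cst.
- apply: aeW => z _ /=; apply: cvg_EFin; first exact: nearW.
  rewrite [X in _ --> X](_ : _ = (G z - G z) ^+ 2); last by rewrite subrr expr0n.
  rewrite expr2; under eq_fun do rewrite /= expr2.
  by apply: cvgM; apply: cvgB => //; exact: cvg_cst.
- exact: iH.
- by apply: aeW => z n _ /=; rewrite lee_fin ger0_norm ?sqr_ge0.
rewrite integral0_eq//= => /fine_cvgP[fin] /cvgrPdist_lt /(_ _ eps0) lt.
have [n [/= nf nl]] := filter_ex (filterI fin lt).
exists (Gn n) => //; rewrite /sqdist -(fineK nf) lee_fin.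
by move: nl; rewrite sub0r normrN => /ltW; apply: le_trans; exact: ler_norm.
Qed.

Lemma approximable_rectangle A B : measurable A -> measurable B ->
  (m1 A < +oo)%E -> (m2 B < +oo)%E -> approximable \1_(A `*` B).
Proof.
move=> mA mB fA fB; split; first by apply: measurable_indic; exact: measurableX.
move=> eps eps0.
have preA : (fun x => x \in A) @^-1` [set true] = A.
  by apply/seteqP; split=> x /=; [exact: set_mem|exact: mem_set].
exists bool, (fun x => x \in A), (fun b y => if b then \1_B y else 0); split.
  split.
  - case.
      by rewrite preA.
    rewrite (_ : _ @^-1` _ = ~` A); first exact: measurableC.
    apply/seteqP; split=> x /=; first by move=> + Ax; rewrite mem_set.
    by move=> nA; rewrite memNset.
  - by case => //; exact: measurable_indic.
  - case; last by rewrite integral0_eq// => y _; rewrite expr0n.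
    rewrite (_ : (fun _ => _) = (fun y => (\1_B y)%:E)); first by rewrite integral_indic// setIT.
    by apply/funext => y; rewrite indicE; case: (y \in B); rewrite ?expr1n ?expr0n.
  - case; [left|by right].
    by rewrite preA.
rewrite /sqdist integral0_eq ?lee_fin ?ltW// => -[x y] _ /=.
rewrite /field_fun /= indicE in_setX /=; case: (x \in A) => /=; rewrite ?subrr ?expr0n//.
Qed.

(** The sets E whose trace on a fixed rectangle of finite measure is
    approximable form a Dynkin system that contains the rectangles, which are
    stable under intersection and generate the product sigma-algebra.  Restricting
    to a rectangle keeps the dominating function integrable. *)
Lemma approximable_measurable A B E : measurable A -> measurable B ->
  (m1 A < +oo)%E -> (m2 B < +oo)%E -> measurable E ->
  approximable \1_(E `&` A `*` B).
Proof.
move=> mA mB fA fB mE.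
pose C : set (set (T1 * T2)) :=
  [set A `*` B | A in measurable & B in measurable]%classic.
have measE : measurable = <<s C >> by rewrite measurable_prod_measurableType.
have mX : measurable (A `*` B) by exact: measurableX.
have fX : (m (A `*` B) < +oo)%E.
  rewrite product_measure1E// -ge0_fin_numE; last exact: mule_ge0.
  by rewrite fin_numM// ge0_fin_numE.
have iX : m.-integrable setT (EFin \o \1_(A `*` B)).
  apply/integrableP; split; first by apply/measurable_EFinP; exact: measurable_indic.
  under eq_integral => z _ do rewrite /= ger0_norm ?indic_ge0//.
  by rewrite integral_indic// setIT.
rewrite measE in mE; move: E mE.
apply: (@dynkin_induction _ _ C) => //.
- move=> _ _ [A1 mA1 [B1 mB1 <-]] [A2 mA2 [B2 mB2 <-]].
  exists (A1 `&` A2); first exact: measurableI.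
  by exists (B1 `&` B2); [exact: measurableI|rewrite setXI].
- by rewrite setTI; exact: approximable_rectangle.
- move=> _ [A1 mA1 [B1 mB1 <-]]; rewrite -setXI.
  apply: approximable_rectangle; try exact: measurableI.
    by apply: le_lt_trans fA; apply: le_measure; rewrite ?inE//; exact: measurableI.
  by apply: le_lt_trans fB; apply: le_measure; rewrite ?inE//; exact: measurableI.
- move=> S mS aS.
  rewrite (_ : \1_(~` S `&` A `*` B) =
    (fun z => \1_(A `*` B) z + (- 1) * \1_(S `&` A `*` B) z)).
    apply: approximableD; first exact: approximable_rectangle.
    exact: approximableZ.
  apply/funext => z; rewrite !indicE !in_setI in_setC.
  by case: (z \in S); case: (z \in A `*` B) => /=; rewrite ?mulN1r ?subrr ?mulr0 ?oppr0 ?addr0.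
- move=> F mF tF aF.
  have FP z : (exists2 k, F k z & forall n,
      \sum_(0 <= j < n) \1_(F j `&` A `*` B) z = (k < n)%N%:R * \1_(A `*` B) z :> R)
      \/ (forall k, ~ F k z).
    case: (pselect (exists k, F k z)) => [[k Fkz]|nF]; last first.
      by right => k Fkz; apply: nF; exists k.
    (* By disjointness k is the only index with z in F k. *)
    left; exists k => // n; case: ltnP => kn.
      rewrite (bigD1_seq k) ?mem_index_iota ?iota_uniq//=.
      rewrite indicE in_setI (mem_set Fkz)/= mul1r -indicE big1 ?addr0// => j jk.
      rewrite indicE in_setI memNset//= => Fjz.
      by move/trivIsetP : tF => /(_ _ _ I I jk)/seteqP[/(_ z (conj Fjz Fkz))].
    rewrite mul0r big_nat big1// => j /= jn.
    rewrite indicE in_setI memNset//= => Fjz.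
    have jk : j != k by rewrite neq_ltn (leq_trans jn kn).
    by move/trivIsetP : tF => /(_ _ _ I I jk)/seteqP[/(_ z (conj Fjz Fkz))].
  apply: (@approximable_dominated _
     (fun n z => \sum_(0 <= k < n) \1_(F k `&` A `*` B) z) \1_(A `*` B)) => //.
  + by apply: measurable_indic; apply: measurableI => //; exact: bigcup_measurable.
  + by move=> n; exact: approximable_sum.
  + move=> z; rewrite indicE in_setI.
    case: (FP z) => [[k Fkz sE]|nF].
      rewrite mem_set/=; last by exists k.
      under eq_fun do rewrite sE.
      apply: cvg_near_cst; exists k.+1 => // n /= kn.
      by rewrite kn mul1r indicE.
    rewrite memNset/=; last by move=> [k _ Fkz]; exact: (nF k).
    apply: cvg_near_cst; apply: nearW => n; rewrite big1//= => k _.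
    by rewrite indicE in_setI memNset.
  + move=> n z; rewrite [X in (X - _) ^+ _ <= _]indicE in_setI.
    case: (FP z) => [[k Fkz sE]|nF].
      rewrite mem_set/=; last by exists k.
      rewrite sE indicE; case: (z \in A `*` B); case: (k < n)%N => /=;
        by rewrite ?mulr1 ?mulr0 ?subrr ?subr0 ?expr0n ?expr1n.
    rewrite memNset/=; last by move=> [k _ Fkz]; exact: (nF k).
    rewrite big1 ?subr0 ?expr0n ?indicE//= => k _.
    by rewrite indicE in_setI memNset.
Qed.


Import HBNNSimple.

(** Simple functions increasing to G, cut off by an exhaustion of the product by
    rectangles of finite measure. *)
Lemma approximable_ge0 G : measurable_fun setT G -> (forall z, 0 <= G z) ->
  (\int[m]_z (G z ^+ 2)%:E < +oo)%E -> approximable G.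
Proof.
move=> mG G0 fG.
have [A [AT ndA fA]] := (sigma_finiteP _ m1).1 (sigma_finiteT m1).
have [B [BT ndB fB]] := (sigma_finiteP _ m2).1 (sigma_finiteT m2).
have [f [ndf cf]] := @approximation _ _ _ setT measurableT (EFin \o G)
  (proj2 (measurable_EFinP _ _) mG) (fun z _ => G0 z).
have mAB n : measurable (A n `*` B n) by apply: measurableX; [case: (fA n)|case: (fB n)].
have cfr z : (f ^~ z : nat -> R) @ \oo --> G z by exact: (fine_cvg (cf z I)).
pose g n z : R := f n z * \1_(A n `*` B n) z.
apply: (@approximable_dominated G g (fun z => G z ^+ 2)) => //.
- move=> n.
  have -> : g n = (fun z => \sum_(y <- finmap.enum_fset (fset_set (range (f n))))
      y * \1_(f n @^-1` [set y] `&` A n `*` B n) z).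
    apply/funext => z; rewrite /g [X in X * _]fimfunE fsbig_finite//= mulr_suml.
    by apply: eq_bigr => i _; rewrite -mulrA !indicE in_setI -mulnb natrM.
  apply: approximable_sum => i; apply: approximableZ.
  by apply: approximable_measurable;
    [case: (fA n)|case: (fB n)|case: (fA n)|case: (fB n)|].
- move=> z; rewrite -[X in _ --> X]mulr1; apply: cvgM.
    exact: cfr.
  have [k _ Ak] : (\bigcup_k A k) z.1 by rewrite -AT.
  have [l _ Bl] : (\bigcup_k B k) z.2 by rewrite -BT.
  apply: cvg_near_cst; exists (maxn k l) => // n /=; rewrite geq_max => /andP[kn ln].
  rewrite indicE mem_set//; split => /=.
    by move: Ak; apply/subsetPset/ndA.
  by move: Bl; apply/subsetPset/ndB.
- apply/integrableP; split; first exact: measurable_esqr.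
  by under eq_integral => z _ do rewrite /= ger0_norm ?sqr_ge0//.
- move=> n z.
  have fle : f n z <= G z.
    rewrite -(cvg_lim _ (cfr z))//; apply: nondecreasing_cvgn_le.
      by move=> a b ab; move/lefP: (ndf _ _ ab); apply.
    by apply/cvg_ex; exists (G z).
  have f0 : 0 <= f n z by exact: fun_ge0.
  rewrite /g indicE; case: (z \in _); rewrite ?mulr1 ?mulr0 ?subr0//=.
  by rewrite ler_pXn2r ?nnegrE ?subr_ge0// gerBl.
Qed.

(** Density of the step fields, by splitting into positive and negative parts. *)
Theorem approximable_L2 G : measurable_fun setT G ->
  (\int[m]_z (G z ^+ 2)%:E < +oo)%E -> approximable G.
Proof.
move=> mG fG.
have part (H : T1 * T2 -> R) : measurable_fun setT H -> (forall z, 0 <= H z <= `|G z|) ->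
    approximable H.
  move=> mH HG; apply: approximable_ge0 => //; first by move=> z; case/andP: (HG z).
  apply: le_lt_trans fG; apply: ge0_le_integral => //; try exact: measurable_esqr.
  - by move=> z _; rewrite lee_fin sqr_ge0.
  - move=> z _; have /andP[h0 h] := HG z.
    by rewrite lee_fin -[leRHS]real_normK ?num_real// ler_pXn2r ?nnegrE.
rewrite (_ : G = (fun z => Num.max (G z) 0 + (- 1) * Num.max (- G z) 0)).
  apply: approximableD; last apply: approximableZ; apply: part.
  - exact: measurable_maxr.
  - by move=> z; rewrite le_max lexx orbT/= ge_max ler_norm normr_ge0.
  - by apply: measurable_maxr => //; exact: measurableT_comp.
  - by move=> z; rewrite le_max lexx orbT/= ge_max -normrN ler_norm normr_ge0.
by apply/funext => z; rewrite mulN1r maxrBN.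
Qed.

End step_approximation.

(** * The change of variables t = s + u, h = u / s *)

Section change_of_variables.
Variable R : realType.
Local Notation mu := (@haar R).
Local Notation mu2 := (mu \x mu)%E.
Implicit Types (p q : R -> R) (z : R * R).

(** The inverse change of variables: for h and 1 + h nonzero, s = t / (1 + h) and
    u = t / (1 + 1 / h) are the numbers with s + u = t and u / s = h. *)
Definition sum_left z : R := (1 + z.1)^-1 * z.2.
Definition sum_right z : R := (1 + z.1^-1)^-1 * z.2.

Lemma measurable_sum_left : measurable_fun setT sum_left.
Proof.
apply: measurable_funM => //.
apply: (measurableT_comp (@measurable_inv R)); exact: measurable_funD.
Qed.

Lemma measurable_sum_right : measurable_fun setT sum_right.
Proof.
apply: measurable_funM => //.
apply: (measurableT_comp (@measurable_inv R)); apply: measurable_funD => //.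
exact: (measurableT_comp (@measurable_inv R)).
Qed.

Lemma haar_ae_generic : {ae mu, forall h : R, h != 0 /\ 1 + h != 0}.
Proof.
have n0 (a : R) : mu.-negligible [set a].
  by apply/negligibleP => //; exact: haar_singleton.
apply: negligibleS (negligibleU (n0 0) (n0 (-1))).
move=> h /= nh; apply: contrapT => /not_orP[/eqP h0 /eqP h1]; apply: nh; split => //.
by rewrite addrC addr_eq0.
Qed.

Lemma sum_rightE h t : h != 0 -> 1 + h != 0 -> sum_right (h, t) = h * sum_left (h, t).
Proof.
move=> h0 h1; rewrite /sum_left /sum_right /= mulrA; congr (_ * t).
have -> : 1 + h^-1 = (1 + h) / h by rewrite mulrDl mul1r divff// addrC.
by rewrite invf_div.
Qed.

Lemma sum_leftD_right h t : h != 0 -> 1 + h != 0 ->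
  sum_left (h, t) + sum_right (h, t) = t.
Proof.
move=> h0 h1; rewrite sum_rightE// -[X in X + _]mul1r -mulrDl /sum_left /=.
by rewrite mulrA divff// mul1r.
Qed.

(** Invariance of dt / |t| under t = (1 + h) s, then Tonelli's theorem, then
    invariance of dh / |h| under u = h s. *)
Lemma integral_change p q :
  measurable_fun setT p -> measurable_fun setT q ->
  (forall s, 0 <= p s) -> (forall s, 0 <= q s) ->
  (\int[mu2]_z (p (sum_left z) * q (sum_right z))%:E =
   (\int[mu]_s (p s)%:E) * (\int[mu]_s (q s)%:E))%E.
Proof.
move=> mp mq p0 q0.
have mpl := measurableT_comp mp measurable_sum_left.
have mqr := measurableT_comp mq measurable_sum_right.
have mf : measurable_fun setT (fun z => (p (sum_left z) * q (sum_right z))%:E).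
  by apply/measurable_EFinP; exact: measurable_funM.
pose g (z : R * R) := (p z.2 * q (z.1 * z.2))%:E.
have mg : measurable_fun setT g.
  apply/measurable_EFinP; apply: measurable_funM; first exact: measurableT_comp.
  by apply: (measurableT_comp mq); exact: measurable_funM.
have g0 z : (0 <= g z)%E by rewrite lee_fin mulr_ge0.
rewrite fubini_tonelli1//; last by move=> z; rewrite lee_fin mulr_ge0.
(* The slices with h = 0 or h = -1 form a null set. *)
transitivity (\int[mu]_h \int[mu]_s g (h, s))%E.
  apply: ge0_ae_eq_integral => //.
  - by apply: measurable_fun_fubini_tonelli_F => // z; rewrite lee_fin mulr_ge0.
  - exact: measurable_fun_fubini_tonelli_F.
  - by move=> h _; apply: integral_ge0 => t _; rewrite lee_fin mulr_ge0.
  - by move=> h _; apply: integral_ge0 => t _; exact: g0.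
  apply: filterS haar_ae_generic => h [h0 h1] _.
  rewrite /fubini_F -[RHS](@haar_integral_scale _ (1 + h)^-1) ?invr_neq0//.
    apply: eq_integral => t _; rewrite /g /=; congr (_ * q _)%:E.
    exact: sum_rightE.
  exact: (measurableT_comp mg).
rewrite fubini_tonelli//.
transitivity (\int[mu]_s ((p s)%:E * \int[mu]_h (q h)%:E))%E.
  apply: ge0_ae_eq_integral => //.
  - exact: (measurable_fun_fubini_tonelli_G g).
  - by apply: emeasurable_funM => //; exact/measurable_EFinP.
  - by move=> h _; apply: integral_ge0 => t _; exact: g0.
  - by move=> h _; rewrite mule_ge0 ?lee_fin// integral_ge0// => t _; rewrite lee_fin.
  apply: filterS haar_ae_generic => s [s0 _] _.
  under eq_integral => h _ do rewrite /g /= EFinM mulrC.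
  rewrite ge0_integralZl ?lee_fin//.
  - by rewrite (@haar_integral_scale _ s (EFin \o q))//; exact/measurable_EFinP.
  - by apply/measurable_EFinP; apply: measurableT_comp => //; exact: measurable_scale.
  - by move=> h _; rewrite lee_fin.
rewrite ge0_integralZr//.
- exact/measurable_EFinP.
- by move=> s _; rewrite lee_fin.
- by apply: integral_ge0 => s _; rewrite lee_fin.
Qed.

(** The change of variables for a pair of integrable functions of either sign.
    As a relation between p and q it is stable under differences in each argument. *)
Definition transported p q : Prop :=
  mu2.-integrable setT (EFin \o (fun z => p (sum_left z) * q (sum_right z))) /\
  Rintegral mu2 setT (fun z => p (sum_left z) * q (sum_right z)) =
  Rintegral mu setT p * Rintegral mu setT q.

Lemma transported_ge0 p q :
  mu.-integrable setT (EFin \o p) -> mu.-integrable setT (EFin \o q) ->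
  (forall s, 0 <= p s) -> (forall s, 0 <= q s) -> transported p q.
Proof.
move=> ip iq p0 q0.
have mp : measurable_fun setT p by apply/measurable_EFinP; exact: measurable_int ip.
have mq : measurable_fun setT q by apply/measurable_EFinP; exact: measurable_int iq.
have E := integral_change mp mq p0 q0.
have fp := integrable_fin_num measurableT ip.
have fq := integrable_fin_num measurableT iq.
split; last by rewrite /Rintegral E fineM.
apply/integrableP; split.
  apply/measurable_EFinP; apply: measurable_funM.
    exact: measurableT_comp mp measurable_sum_left.
  exact: measurableT_comp mq measurable_sum_right.
under eq_integral => z _ do rewrite /= ger0_norm ?mulr_ge0//.
by rewrite E -ge0_fin_numE ?fin_numM// mule_ge0// integral_ge0// => s _; rewrite lee_fin.
Qed.

Lemma transportedBl p p' q :
  mu.-integrable setT (EFin \o p) -> mu.-integrable setT (EFin \o p') ->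
  transported p q -> transported p' q -> transported (fun s => p s - p' s) q.
Proof.
move=> ip ip' [i1 e1] [i2 e2].
split.
  rewrite (_ : EFin \o _ = ((EFin \o (fun z => (p (sum_left z) * q (sum_right z))%R)) \-
      (EFin \o (fun z => (p' (sum_left z) * q (sum_right z))%R)))%E).
    exact: integrableB.
  by apply/funext => z /=; rewrite mulrBl EFinB.
under [LHS]eq_Rintegral do rewrite /= mulrBl.
by rewrite !RintegralB// e1 e2 mulrBl.
Qed.

Lemma transportedBr p q q' :
  mu.-integrable setT (EFin \o q) -> mu.-integrable setT (EFin \o q') ->
  transported p q -> transported p q' -> transported p (fun s => q s - q' s).
Proof.
move=> iq iq' [i1 e1] [i2 e2].
split.
  rewrite (_ : EFin \o _ = ((EFin \o (fun z => (p (sum_left z) * q (sum_right z))%R)) \-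
      (EFin \o (fun z => (p (sum_left z) * q' (sum_right z))%R)))%E).
    exact: integrableB.
  by apply/funext => z /=; rewrite mulrBr EFinB.
under [LHS]eq_Rintegral do rewrite /= mulrBr.
by rewrite !RintegralB// e1 e2 mulrBr.
Qed.

Lemma integrable_pos p : mu.-integrable setT (EFin \o p) ->
  mu.-integrable setT (EFin \o (fun s => Num.max (p s) 0)).
Proof.
move=> ip; apply: (le_integrable measurableT _ _ ip).
  apply/measurable_EFinP; apply: measurable_maxr => //.
  by apply/measurable_EFinP; exact: measurable_int ip.
move=> s _ /=; rewrite lee_fin ger0_norm ?le_max ?lexx ?orbT//.
by rewrite ge_max ler_norm normr_ge0.
Qed.

Lemma transportedP p q :
  mu.-integrable setT (EFin \o p) -> mu.-integrable setT (EFin \o q) ->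
  transported p q.
Proof.
move=> ip iq.
have iN (f : R -> R) : mu.-integrable setT (EFin \o f) ->
    mu.-integrable setT (EFin \o (fun s => - f s)).
  move=> i; rewrite (_ : EFin \o _ = (-%E \o (EFin \o f))%E); first exact: integrableN.
  by apply/funext.
have pos (f : R -> R) s : 0 <= Num.max (f s) 0 by rewrite le_max lexx orbT.
rewrite (_ : p = (fun s => Num.max (p s) 0 - Num.max (- p s) 0)); last first.
  by apply/funext => s; rewrite maxrBN.
rewrite (_ : q = (fun s => Num.max (q s) 0 - Num.max (- q s) 0)); last first.
  by apply/funext => s; rewrite maxrBN.
have [ip1 ip2] := (integrable_pos ip, integrable_pos (iN _ ip)).
have [iq1 iq2] := (integrable_pos iq, integrable_pos (iN _ iq)).
by apply: transportedBl => //; apply: transportedBr => //; exact: transported_ge0.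
Qed.

Section complex_transport.
Variables P Q : R -> R[i].
Hypotheses (cP : cintegrable P) (cQ : cintegrable Q).

Let W z : R[i] := P (sum_left z) * Q (sum_right z).

Let transportReIm (r s : R[i] -> R) :
  (forall f, cintegrable f -> mu.-integrable setT (EFin \o (r \o f))) ->
  (forall f, cintegrable f -> mu.-integrable setT (EFin \o (s \o f))) ->
  transported (r \o P) (s \o Q).
Proof. by move=> hr hs; apply: transportedP; [exact: hr|exact: hs]. Qed.

Let slice_integral (f : R * R -> R) : mu2.-integrable setT (EFin \o f) ->
  mu.-integrable setT (EFin \o (fun h => Rintegral mu setT (fun t => f (h, t)))) /\
  Rintegral mu setT (fun h => Rintegral mu setT (fun t => f (h, t))) =
  Rintegral mu2 setT f.
Proof.
move=> i.
have iF := integrable_fubini_F i.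
have ae : ae_eq mu setT (fubini_F mu (EFin \o f))
    (EFin \o (fun h => Rintegral mu setT (fun t => f (h, t)))).
  have := integrable_ae measurableT iF; apply: filterS => h /= /(_ I) fin _.
  by rewrite fineK.
have mR : measurable_fun setT (EFin \o (fun h => Rintegral mu setT (fun t => f (h, t)))).
  apply/measurable_EFinP; apply: (measurableT_comp (fine_measurable measurableT)).
  exact: measurable_int iF.
split.
  apply/integrableP; split => //; have /integrableP[_] := iF.
  congr (_ < _)%E; apply: ae_eq_integral => //.
  - by apply: measurableT_comp => //; exact: measurable_int iF.
  - exact: measurableT_comp.
  - by apply: filterS ae => h hE /hE ->.
rewrite [RHS]/Rintegral -integral12_prod_meas1//; congr fine.
by apply/esym/ae_eq_integral => //; exact: measurable_int iF.
Qed.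

(** Fubini's theorem for complex products, reduced to the four products of real
    and imaginary parts. *)
Lemma Cintegral_transport :
  let c := fun h => Cintegral (fun t => P (sum_left (h, t)) * Q (sum_right (h, t))) in
  [/\ mu.-integrable setT (EFin \o (fun h => complex.Re (c h))),
      mu.-integrable setT (EFin \o (fun h => complex.Im (c h))) &
      Cintegral c = Cintegral P * Cintegral Q].
Proof.
move=> c.
have rr := transportReIm (@cintegrable_Re R) (@cintegrable_Re R).
have ri := transportReIm (@cintegrable_Re R) (@cintegrable_Im R).
have ir := transportReIm (@cintegrable_Im R) (@cintegrable_Re R).
have ii := transportReIm (@cintegrable_Im R) (@cintegrable_Im R).
have ReE z : complex.Re (W z) =
    complex.Re (P (sum_left z)) * complex.Re (Q (sum_right z)) -
    complex.Im (P (sum_left z)) * complex.Im (Q (sum_right z)).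
  by rewrite /W /=; case: (P _) (Q _) => ? ? [].
have ImE z : complex.Im (W z) =
    complex.Re (P (sum_left z)) * complex.Im (Q (sum_right z)) +
    complex.Im (P (sum_left z)) * complex.Re (Q (sum_right z)).
  by rewrite /W /=; case: (P _) (Q _) => ? ? [].
have iRe : mu2.-integrable setT (EFin \o (fun z => complex.Re (W z))).
  under eq_fun do rewrite ReE.
  exact: (integrableB measurableT rr.1 ii.1).
have iIm : mu2.-integrable setT (EFin \o (fun z => complex.Im (W z))).
  under eq_fun do rewrite ImE.
  exact: (integrableD measurableT ri.1 ir.1).
have [cr er] := slice_integral iRe.
have [ci ei] := slice_integral iIm.
split => //; rewrite [LHS]/Cintegral [X in X +i* _ = _]er [X in _ +i* X = _]ei.
under [X in X +i* _]eq_Rintegral do rewrite ReE.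
under [X in _ +i* X]eq_Rintegral do rewrite ImE.
rewrite RintegralB//; [|exact: rr.1|exact: ii.1].
rewrite RintegralD//; [|exact: ri.1|exact: ir.1].
by rewrite rr.2 ri.2 ir.2 ii.2.
Qed.

End complex_transport.

End change_of_variables.

(** * Square-integrable fields of vectors *)

Section fields.
Variable R : realType.
Local Notation mu := (@haar R).
Local Notation mu2 := (mu \x mu)%E.
Local Notation vec := (R -> R[i]).
Implicit Types X Y : R -> vec.

(** A jointly measurable field of vectors h |-> X h. *)
Definition field2 X : Prop := cmeas (fun z : R * R => X z.1 z.2).

Definition sqnorm2 X : \bar R := (\int[mu]_h sq (X h))%E.

Lemma field2_slice X h : field2 X -> cmeas (X h).
Proof. by move=> mX; exact: (cmeas_comp mX (pair1_measurable h)). Qed.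

Lemma field2B X Y : field2 X -> field2 Y -> field2 (fun h => X h - Y h).
Proof. exact: cmeasB. Qed.

Lemma measurable_sq X : field2 X -> measurable_fun setT (fun h => sq (X h)).
Proof.
move=> mX; apply: (@measurable_fun_fubini_tonelli_F _ _ _ _ _ mu (fun z => (csq (X z.1 z.2))%:E)).
  exact: measurable_ecsq mX.
by move=> z; rewrite lee_fin csq_ge0.
Qed.

Lemma sqnorm2_ge0 X : (0 <= sqnorm2 X)%E.
Proof. by apply: integral_ge0 => h _; exact: sq_ge0. Qed.

Lemma sqnorm2E X : field2 X -> sqnorm2 X = (\int[mu2]_z (csq (X z.1 z.2))%:E)%E.
Proof.
move=> mX; rewrite fubini_tonelli1//; first exact: measurable_ecsq mX.
by move=> z; rewrite lee_fin csq_ge0.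
Qed.

Lemma sqnorm2D X Y : field2 X -> field2 Y ->
  (sqnorm2 (fun h => X h + Y h)%R <= 2%:E * sqnorm2 X + 2%:E * sqnorm2 Y)%E.
Proof.
move=> mX mY; rewrite /sqnorm2 -!ge0_integralZl//; try exact: measurable_sq;
  try by move=> h _; exact: sq_ge0.
rewrite -ge0_integralD//; try by move=> h _; rewrite mule_ge0// sq_ge0.
  2,3: by apply: measurable_funeM; exact: measurable_sq.
apply: ge0_le_integral => //.
- by move=> h _; exact: sq_ge0.
- by apply: measurable_sq; exact: cmeasD.
- by apply: emeasurable_funD; apply: measurable_funeM; exact: measurable_sq.
- by move=> h _; apply: sqD; exact: field2_slice.
Qed.

Lemma sqnorm2B X Y : field2 X -> field2 Y ->
  (sqnorm2 (fun h => X h - Y h)%R <= 2%:E * sqnorm2 X + 2%:E * sqnorm2 Y)%E.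
Proof.
move=> mX mY; apply: (le_trans (sqnorm2D mX (cmeasN mY))).
have -> // : sqnorm2 (fun h => - Y h) = sqnorm2 Y.
by apply: eq_integral => h _; exact: sqN.
Qed.

Lemma integral_diff_bound d X Y X' Y' : 0 < d ->
  field2 X -> field2 Y -> field2 X' -> field2 Y' ->
  measurable_fun setT (fun h => diff_bound d (X h) (Y h) (X' h) (Y' h)) /\
  (\int[mu]_h diff_bound d (X h) (Y h) (X' h) (Y' h) =
   d%:E * (sqnorm2 X + sqnorm2 Y) +
   (2 / d)%:E * (sqnorm2 (fun h => X h - X' h)%R + sqnorm2 (fun h => Y h - Y' h)%R))%E.
Proof.
move=> d0 mX mY mX' mY'.
have [mx my] := (measurable_sq mX, measurable_sq mY).
have [mdx mdy] := (measurable_sq (field2B mX mX'), measurable_sq (field2B mY mY')).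
have d2 : 0 <= 2 / d by rewrite divr_ge0// ltW.
have m1 : measurable_fun setT (fun h => d%:E * (sq (X h) + sq (Y h)))%E.
  by apply: measurable_funeM; exact: emeasurable_funD.
have m2 : measurable_fun setT
    (fun h => (2 / d)%:E * (sq (X h - X' h)%R + sq (Y h - Y' h)%R))%E.
  by apply: measurable_funeM; exact: emeasurable_funD.
split; first exact: emeasurable_funD.
have pos (Z W : R -> vec) h : (0 <= sq (Z h) + sq (W h))%E by rewrite adde_ge0// sq_ge0.
have add (Z W : R -> vec) : measurable_fun setT (fun h => sq (Z h)) ->
    measurable_fun setT (fun h => sq (W h)) ->
    (\int[mu]_h (sq (Z h) + sq (W h)) = sqnorm2 Z + sqnorm2 W)%E.
  by move=> mZ mW; rewrite ge0_integralD// => h _; exact: sq_ge0.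
rewrite -add// -(add _ _ mdx mdy).
have scale (c : R) (f : R -> \bar R) : 0 <= c -> measurable_fun setT f ->
    (forall h, 0 <= f h)%E -> (\int[mu]_h (c%:E * f h) = c%:E * \int[mu]_h f h)%E.
  by move=> c0 mf f0; rewrite ge0_integralZl.
have mXY := emeasurable_funD mx my; have mdXY := emeasurable_funD mdx mdy.
rewrite -(scale _ _ (ltW d0) mXY (pos X Y)).
rewrite -(scale _ _ d2 mdXY (pos (fun h => X h - X' h) (fun h => Y h - Y' h))).
rewrite -ge0_integralD// => h _; first by rewrite mule_ge0 ?lee_fin ?(ltW d0)// pos.
by rewrite mule_ge0 ?lee_fin// (pos (fun h => X h - X' h) (fun h => Y h - Y' h)).
Qed.

Lemma diff_bound_ge0 d (f k f' k' : vec) : 0 < d -> (0 <= diff_bound d f k f' k')%E.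
Proof.
move=> d0; have dd : 0 <= 2 / d by rewrite divr_ge0// ltW.
apply: adde_ge0; apply: mule_ge0; rewrite ?lee_fin ?(ltW d0)//;
  by apply: adde_ge0; exact: sq_ge0.
Qed.

Definition twist (f g : vec) (h : R) : vec := lambda (1 + h) f * lambda (1 + h^-1) g.

Lemma twistE f g h t : twist f g h t = f (sum_left (h, t)) * g (sum_right (h, t)).
Proof. by []. Qed.

Lemma field2_twist f g : cmeas f -> cmeas g -> field2 (twist f g).
Proof.
move=> mf mg; apply: cmeasM.
  exact: (cmeas_comp mf (@measurable_sum_left R)).
exact: (cmeas_comp mg (@measurable_sum_right R)).
Qed.

(** The fields in the theorem are square-integrable, and their square norms
    factor, because the squared modulus of a product is a product. *)
Lemma sqnorm2_twist f g : cmeas f -> cmeas g ->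
  (sqnorm2 (twist f g) = sq f * sq g)%E.
Proof.
move=> mf mg; rewrite sqnorm2E; last exact: field2_twist.
have := integral_change (measurable_csq mf) (measurable_csq mg)
  (fun s => csq_ge0 (f s)) (fun s => csq_ge0 (g s)).
by move=> <-; apply: eq_integral => -[h t] _; rewrite csqM.
Qed.

Lemma sqnorm2_twist_lty f g : L2 f -> L2 g -> (sqnorm2 (twist f g) < +oo)%E.
Proof.
move=> hf hg; rewrite sqnorm2_twist; [|exact: L2_cmeas|exact: L2_cmeas].
by rewrite -ge0_fin_numE ?mule_ge0 ?sq_ge0// fin_numM// sq_fin.
Qed.

(** Two step fields on a common partition of the h-axis, given by the map that
    sends h to the index of its cell. *)
Record vstep := VStep {
  vindex : finType;
  vcell : R -> vindex;
  vleft : vindex -> vec;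
  vright : vindex -> vec }.

Definition vstep_ok (s : vstep) : Prop :=
  [/\ forall i, measurable (@vcell s @^-1` [set i]),
      forall i, L2 (@vleft s i), forall i, L2 (@vright s i) &
      forall i, (mu (@vcell s @^-1` [set i]) < +oo)%E \/
        @vleft s i = 0 /\ @vright s i = 0].

Definition left_field s h : vec := @vleft s (@vcell s h).
Definition right_field s h : vec := @vright s (@vcell s h).

Lemma field2_cells (I : finType) (e : R -> I) (phi : I -> vec) :
  (forall i, measurable (e @^-1` [set i])) -> (forall i, cmeas (phi i)) ->
  field2 (fun h => phi (e h)).
Proof.
move=> me mphi; split.
- apply: (@measurable_cells _ _ _ _ _ _ e (fun i z => complex.Re (phi i z.2))) => // i.
  by apply: (measurableT_comp (proj1 (mphi i))).
- apply: (@measurable_cells _ _ _ _ _ _ e (fun i z => complex.Im (phi i z.2))) => // i.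
  by apply: (measurableT_comp (proj2 (mphi i))).
Qed.

(** The real and imaginary parts are approximated separately and recombined on
    the common refinement. *)
Lemma complex_approximation X (eps : R) : 0 < eps -> field2 X -> (sqnorm2 X < +oo)%E ->
  exists (I : finType) (e : R -> I) (phi : I -> vec),
  [/\ forall i, measurable (e @^-1` [set i]), forall i, L2 (phi i),
      forall i, (mu (e @^-1` [set i]) < +oo)%E \/ phi i = 0 &
      (sqnorm2 (fun h => X h - phi (e h))%R <= eps%:E)%E].
Proof.
move=> eps0 mX fX.
have part (r : R * R -> R) : measurable_fun setT r ->
    (forall z, r z ^+ 2 <= csq (X z.1 z.2)) -> approximable mu mu r.
  move=> mr rX; apply: approximable_L2 => //.
  move: fX; rewrite sqnorm2E//; apply: le_lt_trans; apply: ge0_le_integral => //.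
  - by move=> z _; rewrite lee_fin sqr_ge0.
  - exact: measurable_esqr.
  - exact: measurable_ecsq mX.
  - by move=> z _; rewrite lee_fin.
have [|_ aRe] := part (fun z => complex.Re (X z.1 z.2)) (proj1 mX).
  by move=> z; rewrite lerDl sqr_ge0.
have [|_ aIm] := part (fun z => complex.Im (X z.1 z.2)) (proj2 mX).
  by move=> z; rewrite lerDr sqr_ge0.
have e20 : 0 < eps / 2 by rewrite divr_gt0.
have [I [e [p [sp dp]]]] := aRe _ e20.
have [J [e' [q [sq' dq]]]] := aIm _ e20.
have [mp mq] := (measurable_field sp, measurable_field sq').
have [me pm pf pc] := sp; have [me' qm qf qc] := sq'.
have cE i : (fun x => (e x, e' x)) @^-1` [set i] =
    e @^-1` [set i.1] `&` e' @^-1` [set i.2].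
  by case: i => i j; apply/seteqP; split => x /= [-> ->].
have mc i : measurable ((fun x => (e x, e' x)) @^-1` [set i]).
  by rewrite cE; exact: measurableI.
have L2pq (i : I * J) : L2 (fun t => p i.1 t +i* q i.2 t).
  apply/L2P; split; first by split; [exact: pm|exact: qm].
  rewrite /sq.
  under eq_integral => t _ do rewrite /csq /= EFinD.
  rewrite ge0_integralD//; try exact: measurable_esqr;
    try by move=> t _; rewrite lee_fin sqr_ge0.
  by rewrite lte_add_pinfty.
exists (I * J)%type, (fun h => (e h, e' h)), (fun i t => p i.1 t +i* q i.2 t); split => //.
- move=> i; rewrite cE; case: (pc i.1) => [f|->].
    left; apply: le_lt_trans f; apply: le_measure; rewrite ?inE//.
    exact: measurableI.
  case: (qc i.2) => [f|->]; last by right; apply/funext.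
  left; apply: le_lt_trans f; apply: le_measure; rewrite ?inE//.
  exact: measurableI.
rewrite sqnorm2E; last first.
  apply: (field2B mX); split.
    exact: mp.
  exact: mq.
rewrite (_ : (\int[mu2]_z _)%E =
  (sqdist mu mu (fun z => complex.Re (X z.1 z.2)) (field_fun e p) +
  sqdist mu mu (fun z => complex.Im (X z.1 z.2)) (field_fun e' q))%E).
  by rewrite [eps]splitr EFinD leeD.
have [mXr mXi] := mX.
rewrite -ge0_integralD//; try by move=> t _; rewrite lee_fin sqr_ge0.
  2,3: by apply: measurable_esqr; exact: measurable_funB.
apply: eq_integral => z _; rewrite -EFinD /csq; congr (_%:E).
rewrite /field_fun [(_ - _) _]/=.
by rewrite [X in _ + X ^+ 2 = _]raddfB [X in X ^+ 2 + _ = _]raddfB.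
Qed.

Lemma pair_approximation X Y (eps : R) : 0 < eps -> field2 X -> field2 Y ->
  (sqnorm2 X < +oo)%E -> (sqnorm2 Y < +oo)%E ->
  exists2 s : vstep, vstep_ok s &
    (sqnorm2 (fun h => X h - left_field s h)%R <= eps%:E)%E /\
    (sqnorm2 (fun h => Y h - right_field s h)%R <= eps%:E)%E.
Proof.
move=> eps0 mX mY fX fY.
have [I [e [p [me Lp fp ap]]]] := complex_approximation eps0 mX fX.
have [J [e' [q [me' Lq fq aq]]]] := complex_approximation eps0 mY fY.
exists (@VStep (I * J)%type (fun h => (e h, e' h)) (fun i => p i.1) (fun i => q i.2)) => //.
have cE i : (fun x => (e x, e' x)) @^-1` [set i] =
    e @^-1` [set i.1] `&` e' @^-1` [set i.2].
  by case: i => i j; apply/seteqP; split => x /= [-> ->].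
split => //= i; rewrite cE; first exact: measurableI.
case: (fp i.1) => [f|->].
  left; apply: le_lt_trans f; apply: le_measure; rewrite ?inE//.
  exact: measurableI.
case: (fq i.2) => [f|->]; last by right.
left; apply: le_lt_trans f; apply: le_measure; rewrite ?inE//.
exact: measurableI.
Qed.

End fields.

(** * Functions constant on the cells of a finite partition *)

Section lower_integral.
Context d (T : measurableType d) (R : realType) (mu : {measure set T -> \bar R}).
Local Open Scope ereal_scope.

(** The integral of a nonnegative function is a supremum over the simple
    functions below it, hence it is monotone without any measurability. *)
Lemma le_integral_ge0 (f g : T -> \bar R) :
  (forall x, 0 <= f x) -> (forall x, f x <= g x) ->
  \int[mu]_x f x <= \int[mu]_x g x.
Proof.
move=> f0 fg; have g0 x : 0 <= g x by exact: le_trans (fg x).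
rewrite !ge0_integralTE//; apply: le_ereal_sup => _ [h hf <-].
by exists h => // x; exact: le_trans (hf x) (fg x).
Qed.

(** The sum of the functions is integrable, hence finite almost everywhere, and
    the terms of a convergent series tend to 0. *)
Lemma ae_cvg0_summable (f : nat -> T -> \bar R) :
  (forall n, measurable_fun setT (f n)) -> (forall n x, 0 <= f n x) ->
  \sum_(0 <= n <oo) \int[mu]_x f n x < +oo ->
  {ae mu, forall x, f n x @[n --> \oo] --> 0}.
Proof.
move=> mf f0 fin.
pose S x := \sum_(0 <= n <oo) f n x.
have mS : measurable_fun setT S by apply: ge0_emeasurable_sum => // n x _ _; exact: f0.
have S0 x : 0 <= S x by apply: nneseries_ge0 => n _ _; exact: f0.
have iS : mu.-integrable setT S.
  apply/integrableP; split => //.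
  under eq_integral => x _ do rewrite gee0_abs//.
  by rewrite integral_nneseries.
have := integrable_ae measurableT iS; apply: filterS => x /= /(_ I) fS.
have Sx : S x < +oo by rewrite -ge0_fin_numE.
have tail := nneseries_tail_cvg Sx (fun n _ => f0 n x).
apply: (squeeze_cvge _ (cvg_cst 0) tail); apply: nearW => n.
rewrite f0/=.
have -> : \sum_(n <= k <oo) f k x = f n x + \sum_(n.+1 <= k <oo) f k x.
  rewrite (@nneseries_split _ _ n 1%N) ?addn1 ?big_nat1//.
by rewrite leeDl// nneseries_ge0.
Qed.

End lower_integral.

Section cells.
Variable R : realType.
Local Notation mu := (@haar R).
Variables (I : finType) (e : R -> I).
Hypothesis me : forall i, measurable (e @^-1` [set i]).
Local Notation cell i := (e @^-1` [set i]).

(** Exactly one cell contains h. *)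
Lemma cell_sum (V : nmodType) (F : I -> R -> V) h :
  (forall i, ~ cell i h -> F i h = 0) -> \sum_i F i h = F (e h) h.
Proof.
move=> F0; rewrite (bigD1 (e h))//= big1 ?addr0// => i ie.
by apply: F0 => /= ei; rewrite ei eqxx in ie.
Qed.

Lemma integral_cells (b : I -> \bar R) : (forall i, 0 <= b i)%E ->
  (\int[mu]_h b (e h) = \sum_i b i * mu (cell i))%E.
Proof.
move=> b0.
transitivity (\int[mu]_h \sum_i (b i * (\1_(cell i) h)%:E))%E.
  apply: eq_integral => h _; rewrite (cell_sum (F := fun i h => b i * (\1_(cell i) h)%:E)%E).
    by rewrite indicE mem_set// mule1.
  by move=> i ni; rewrite indicE memNset// mule0.
rewrite ge0_integral_sum//.
- apply: eq_bigr => i _; rewrite ge0_integralZl//.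
  + by rewrite integral_indic// setIT.
  + by apply/measurable_EFinP; exact: measurable_indic.
- by move=> i; apply: measurable_funeM; apply/measurable_EFinP; exact: measurable_indic.
- by move=> i h _; rewrite mule_ge0.
Qed.

(** Only an inequality, because [fine] sends an infinite measure to 0. *)
Lemma sum_cells_le (b : I -> \bar R) : (forall i, 0 <= b i)%E ->
  (\sum_i (fine (mu (cell i)))%:E * b i <= \int[mu]_h b (e h))%E.
Proof.
move=> b0; rewrite integral_cells//; apply: lee_sum => i _.
rewrite muleC lee_wpmul2l//.
have fine_le (x : \bar R) : (0 <= x -> (fine x)%:E <= x)%E.
  by case: x => [r||]//= _; rewrite leey.
exact: fine_le (measure_ge0 _ _).
Qed.

(** Each indicator of a cell of finite measure is integrable; cells of infinite
    measure carry the value 0, so that the convention for [fine] does no harm. *)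
Lemma Cintegral_cells (a : I -> R[i]) :
  (forall i, (mu (cell i) < +oo)%E \/ a i = 0) ->
  cintegrable (fun h => a (e h)) /\
  Cintegral (fun h => a (e h)) = \sum_i (fine (mu (cell i)))%:C * a i.
Proof.
move=> fa.
pose P (f : R -> R[i]) (v : R[i]) := cintegrable f /\ Cintegral f = v.
have P0 : P (fun=> 0) 0.
  split; first split; first by [].
    by rewrite integral0_eq// => t _; rewrite normc_sqrt /csq /= expr0n addr0 sqrtr0.
  by rewrite /Cintegral /= /Rintegral integral0_eq.
have Plin (c : R[i]) f v g w : P f v -> P g w -> P (fun h => c * f h + g h) (c * v + w).
  move=> [cf <-] [cg <-]; split; last exact: Cintegral_linear.
  have [mf ff] := cf; have [mg fg] := cg.
  have mcf : cmeas (fun h => c * f h) by apply: cmeasM => //; exact: cmeas_cst.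
  split; first exact: cmeasD.
  apply: (@le_lt_trans _ _ (\int[mu]_t ((normc c)%:E * (normc (f t))%:E + (normc (g t))%:E))%E).
    apply: ge0_le_integral => //.
    - by move=> t _; rewrite lee_fin normc_ge0.
    - by apply: measurable_enormc; exact: cmeasD.
    - apply: emeasurable_funD; last exact: measurable_enormc.
      by apply: measurable_funeM; exact: measurable_enormc.
    - move=> t _; rewrite -EFinM -EFinD lee_fin -normcM.
      exact: ler_normcD.
  rewrite ge0_integralD//.
  - rewrite ge0_integralZl//; first by rewrite lte_add_pinfty// lte_mul_pinfty// lee_fin normc_ge0.
    + exact: measurable_enormc.
    + by move=> t _; rewrite lee_fin normc_ge0.
    + by rewrite lee_fin normc_ge0.
  - by move=> t _; rewrite -EFinM lee_fin mulr_ge0// normc_ge0.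
  - by apply: measurable_funeM; exact: measurable_enormc.
  - by move=> t _; rewrite lee_fin normc_ge0.
  - exact: measurable_enormc.
have P1 i : (mu (cell i) < +oo)%E -> P (fun h => (\1_(cell i) h)%:C) (fine (mu (cell i)))%:C.
  move=> fi; split; first split.
  - by split => //=; exact: measurable_indic.
  - under eq_integral => t _ do rewrite normc_sqrt /csq /= expr0n addr0 sqrtr_sqr ger0_norm//.
    by rewrite integral_indic// setIT.
  - rewrite /Cintegral /= /Rintegral integral_indic// setIT.
    by rewrite integral0_eq.
have Pi i : P (fun h => a i * (\1_(cell i) h)%:C) ((fine (mu (cell i)))%:C * a i).
  case: (fa i) => [fi|->].
    have := Plin (a i) _ _ _ _ (P1 _ fi) P0.
    by under eq_fun do rewrite addr0; rewrite addr0 mulrC.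
  by under eq_fun do rewrite mul0r; rewrite mulr0.
have : P (fun h => \sum_i a i * (\1_(cell i) h)%:C) (\sum_i (fine (mu (cell i)))%:C * a i).
  elim: (index_enum I) => [|i r IH].
    by under eq_fun do rewrite big_nil; rewrite big_nil.
  under eq_fun do rewrite big_cons; rewrite big_cons.
  have := Plin 1 _ _ _ _ (Pi i) IH.
  by under eq_fun do rewrite mul1r; rewrite mul1r.
rewrite (_ : (fun h => \sum_i _) = (fun h => a (e h)))//.
apply/funext => h; rewrite (cell_sum (F := fun i h => a i * (\1_(cell i) h)%:C)).
  by rewrite indicE mem_set// mulr1.
by move=> i ni; rewrite indicE memNset// mulr0.
Qed.

End cells.

Section bochner_steps.
Variable R : realType.
Local Notation mu := (@haar R).
Variable s : vstep R.
Hypothesis ok : vstep_ok s.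
Local Notation I := (vindex s).
Local Notation cell i := (@vcell _ s @^-1` [set i]).

(** Bochner steps require sets of finite measure.  Emptying an infinite cell
    changes nothing, as the vectors there are 0. *)
Definition finite_cell (i : I) : set R :=
  if (mu (cell i) < +oo)%E then cell i else set0.

Definition bochner_step : step R (affine R -> R[i]) :=
  @Step _ _ R (affine R -> R[i]) #|I| (fun k => finite_cell (enum_val k))
    (fun k => coef (@vleft _ s (enum_val k)) (@vright _ s (enum_val k))).

Lemma coef_infinite_cell i : ~~ (mu (cell i) < +oo)%E -> coef (@vleft _ s i) (@vright _ s i) = 0.
Proof.
have [_ _ _ /(_ i)[->//|[-> ->]]] := ok => _.
by apply: coef0l; exact: L20.
Qed.

Lemma Api_norm_coef (f k : R -> R[i]) : L2 f -> L2 k -> (Api_norm (coef f k) < +oo)%E.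
Proof.
move=> hf hk.
have hl p : p \in [:: (f, k)] -> L2pair p by rewrite inE => /eqP ->.
have := (Api_finite hl).2; rewrite /tensor_coef !big_seq1; move/le_lt_trans; apply.
by rewrite -ge0_fin_numE ?weight_ge0// fin_numM// L2norm_fin.
Qed.

Lemma bochner_step_integrable : step_integrable mu (@Api_norm R) bochner_step.
Proof.
have [mc hl hr _] := ok.
move=> k; split => /=.
- by rewrite /finite_cell; case: ifP.
- by rewrite /finite_cell; case: ifP => // _; rewrite measure0.
- exact: Api_norm_coef.
Qed.

Lemma bochner_step_fun h :
  step_fun bochner_step h = coef (left_field s h) (right_field s h).
Proof.
rewrite /step_fun /=.
pose value i h' := (\1_(finite_cell i) h')%:C *: coef (@vleft _ s i) (@vright _ s i).
rewrite -(big_enum_val (A := I) (fun i => value i h)) /=.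
rewrite (@cell_sum _ _ (@vcell _ s) _ value) /value.
  rewrite /finite_cell; case: ifPn => [f|/coef_infinite_cell c0].
    by rewrite indicE mem_set// scale1r.
  by rewrite /left_field /right_field c0 scaler0.
move=> i ni.
have nf : ~ finite_cell i h by rewrite /finite_cell; case: ifP => _; [exact: ni|].
by rewrite indicE memNset// scale0r.
Qed.

(** At each g the formal integral of a step is a Lebesgue integral, and so does
    not depend on the partition used to write the step. *)
Lemma bochner_step_integral g :
  cintegrable (fun h => coef (left_field s h) (right_field s h) g) /\
  step_integral mu bochner_step g =
  Cintegral (fun h => coef (left_field s h) (right_field s h) g).
Proof.
have [mc hl hr fc] := ok.
have [|ci ->] := @Cintegral_cells _ _ (@vcell _ s) mc
  (fun i => coef (@vleft _ s i) (@vright _ s i) g).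
  move=> i; case: (fc i) => [|[-> ->]]; first by left.
  by right; rewrite coef0l//; exact: L20.
split => //; rewrite /step_integral fct_sumE /=.
rewrite -(big_enum_val (A := I) (fun i =>
  ((fine (mu (finite_cell i)))%:C *: coef (@vleft _ s i) (@vright _ s i)) g)) /=.
apply: eq_bigr => i _; rewrite /finite_cell; case: ifPn => [//|/coef_infinite_cell c0].
by rewrite c0 scaler0 mulr0.
Qed.

End bochner_steps.

(** * Increments between two step approximations *)

Section refinement.
Variable R : realType.
Local Notation mu := (@haar R).
Local Notation vec := (R -> R[i]).
Variables s s' : vstep R.
Hypotheses (ok : vstep_ok s) (ok' : vstep_ok s').

Definition common_cell (h : R) : vindex s * vindex s' := (@vcell _ s h, @vcell _ s' h).

Definition cell_diff (k : vindex s * vindex s') : seq (vec * vec) :=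
  diff_tensors (@vleft _ s' k.2) (@vright _ s' k.2) (@vleft _ s k.1) (@vright _ s k.1).

(** Tensors representing the difference of the integrals of two steps.  On the
    cells of the common refinement both steps are constant, so the total weight
    is controlled by the integral over h of the distance between them. *)
Definition increment_tensors : seq (vec * vec) :=
  [seq scale_tensor (fine (mu (common_cell @^-1` [set k]))) p |
    k <- index_enum (vindex s * vindex s')%type, p <- cell_diff k].

Let cellE k : common_cell @^-1` [set k] =
  @vcell _ s @^-1` [set k.1] `&` @vcell _ s' @^-1` [set k.2].
Proof. by case: k => i j; apply/seteqP; split => x /= [<- <-]. Qed.

Let mcell k : measurable (common_cell @^-1` [set k]).
Proof. by rewrite cellE; apply: measurableI; [case: ok|case: ok']. Qed.

Let L2_cell_diff k (p : vec * vec) : p \in cell_diff k -> L2pair p.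
Proof.
have [_ hl hr _] := ok; have [_ hl' hr' _] := ok'.
exact: L2_diff_tensors.
Qed.

Lemma L2_increment (p : vec * vec) : p \in increment_tensors -> L2pair p.
Proof.
move=> /allpairsPdep[k [q [_ qk ->]]].
by apply: L2_scale_tensor; exact: L2_cell_diff qk.
Qed.

(** Both step integrals are Lebesgue integrals, and their difference is the
    integral of a function that is constant on the common cells. *)
Lemma increment_coef g : tensor_coef increment_tensors g =
  step_integral mu (bochner_step s') g - step_integral mu (bochner_step s) g.
Proof.
have [_ hl hr fc] := ok; have [_ hl' hr' fc'] := ok'.
rewrite tensor_coefE /increment_tensors big_allpairs_dep /=.
pose a k := coef (@vleft _ s' k.2) (@vright _ s' k.2) g -
  coef (@vleft _ s k.1) (@vright _ s k.1) g.
have fa k : (mu (common_cell @^-1` [set k]) < +oo)%E \/ a k = 0.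
  have [m1 m2] : measurable (@vcell _ s @^-1` [set k.1]) /\ measurable (@vcell _ s' @^-1` [set k.2]).
    by split; [case: ok|case: ok'].
  have m12 := measurableI _ _ m1 m2.
  rewrite cellE; case: (fc k.1) => [f|[E1 E2]].
    by left; apply: le_lt_trans f; apply: le_measure; rewrite ?inE.
  case: (fc' k.2) => [f|[E1' E2']].
    by left; apply: le_lt_trans f; apply: le_measure; rewrite ?inE.
  right; rewrite /a E1 E2 E1' E2' coef0l ?subrr//; exact: L20.
transitivity (\sum_k (fine (mu (common_cell @^-1` [set k])))%:C * a k).
  apply: eq_bigr => k _.
  rewrite /a -[X in _ * X]/((coef (@vleft _ s' k.2) (@vright _ s' k.2) -
     coef (@vleft _ s k.1) (@vright _ s k.1)) g) -coef_diff_tensors//.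
  rewrite tensor_coefE mulr_sumr big_seq [RHS]big_seq; apply: eq_bigr => p pk.
  by rewrite coef_scale_tensor//; exact: L2_cell_diff pk.
have [_ <-] := @Cintegral_cells _ _ common_cell mcell a fa.
have [c1 ->] := bochner_step_integral ok g.
have [c2 ->] := bochner_step_integral ok' g.
have := Cintegral_linear (-1) c1 c2; rewrite mulN1r addrC => <-.
by congr Cintegral; apply/funext => h; rewrite mulN1r addrC.
Qed.

Lemma increment_weight d : 0 < d -> d <= 1 ->
  (\sum_(p <- increment_tensors) weight p <= \int[mu]_h diff_bound d
     (left_field s' h) (right_field s' h) (left_field s h) (right_field s h))%E.
Proof.
move=> d0 d1.
have [_ hl hr fc] := ok; have [_ hl' hr' fc'] := ok'.
pose b k := diff_bound d (@vleft _ s' k.2) (@vright _ s' k.2) (@vleft _ s k.1) (@vright _ s k.1).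
have b0 k : (0 <= b k)%E by exact: diff_bound_ge0.
apply: (le_trans _ (sum_cells_le mcell b0)).
rewrite /increment_tensors big_allpairs_dep /=; apply: lee_sum => k _.
have m0 : 0 <= fine (mu (common_cell @^-1` [set k])) by apply: fine_ge0.
apply: (@le_trans _ _ ((fine (mu (common_cell @^-1` [set k])))%:E *
   \sum_(p <- cell_diff k) weight p)%E).
  rewrite ge0_sume_distrr; last by move=> p _; exact: weight_ge0.
  rewrite big_seq [leRHS]big_seq; apply: lee_sum => p pk.
  by rewrite weight_scale_tensor//; exact: L2_cell_diff pk.
by rewrite lee_wpmul2l ?lee_fin//; exact: weight_diff_tensors.
Qed.

End refinement.

(** * Fields of coefficients are Bochner integrable *)

Section dyadic.
Variable R : realType.

(** Indexed so that the shifted series sums to a power of 1 / 2. *)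
Definition dyadic (n : nat) : R := ((2 ^ n.+1)%:R)^-1.

Lemma dyadic_gt0 n : 0 < dyadic n.
Proof. by rewrite invr_gt0 ltr0n expn_gt0. Qed.

Lemma dyadic_le1 n : dyadic n <= 1.
Proof. by rewrite invf_le1 ?ltr0n ?expn_gt0// ler1n expn_gt0. Qed.

Lemma dyadic_decr n : dyadic n.+1 <= dyadic n.
Proof.
by rewrite lef_pV2 ?posrE ?ltr0n ?expn_gt0// ler_nat leq_exp2l.
Qed.

Lemma dyadic_cvg (C : R) : (fun n => C * dyadic n) @ \oo --> (0 : R).
Proof.
have -> : (fun n => C * dyadic n) = geometric (C / 2) (2^-1).
  apply/funext => n /=; rewrite /dyadic natrX exprS exprVn.
  by field; rewrite expf_neq0.
by apply: cvg_geometric; rewrite ger0_norm ?invr_ge0//; lra.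
Qed.

Lemma dyadic_series (C : R) n :
  (\sum_(0 <= m <oo) (C * dyadic (n + m))%:E = (C / 2 ^+ n)%:E)%E.
Proof.
have := @cvg_geometric_eseries_half R C n => /cvg_lim <-//.
by congr (limn _); apply/funext => k; rewrite /eseries /=; apply: eq_bigr => m _;
  rewrite /dyadic addnS addnC.
Qed.

End dyadic.

Section extended_real_bounds.
Variable R : realType.
Local Open Scope ereal_scope.
Implicit Types (x y : \bar R) (a b d e : R).

Lemma twice_sum_le x y e : x <= e%:E -> y <= e%:E ->
  2%:E * x + 2%:E * y <= (4 * e)%:E.
Proof.
move=> xe ye; apply: (@le_trans _ _ (2%:E * e%:E + 2%:E * e%:E)).
  by apply: leeD; rewrite lee_pmul2l.
by rewrite -!EFinM -EFinD lee_fin; lra.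
Qed.

Lemma twice_add2_le x y a : x <= a%:E -> y <= 1 -> 2%:E * x + 2%:E * y <= (2 * a + 2)%:E.
Proof.
move=> xa y1; apply: (@le_trans _ _ (2%:E * a%:E + 2%:E * 1%:E)).
  by apply: leeD; rewrite lee_pmul2l.
by rewrite -!EFinM -EFinD lee_fin; lra.
Qed.

Lemma weighted_sum_le d x y a b c : (0 < d)%R -> x <= a%:E -> y <= b%:E ->
  (d * a + 2 / d * b = c)%R -> d%:E * x + (2 / d)%:E * y <= c%:E.
Proof.
move=> d0 xa yb <-; rewrite EFinD !EFinM; apply: leeD; rewrite lee_wpmul2l// lee_fin ?ltW//.
by rewrite divr_gt0.
Qed.

End extended_real_bounds.

Section bochner_integral_of_coefficients.
Variable R : realType.
Local Notation mu := (@haar R).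
Local Notation vec := (R -> R[i]).
Variables X Y : R -> vec.
Hypotheses (mX : field2 X) (mY : field2 Y).
Hypotheses (fX : (sqnorm2 X < +oo)%E) (fY : (sqnorm2 Y < +oo)%E).

Lemma Api_norm_ge0 (u : affine R -> R[i]) : (0 <= Api_norm u)%E.
Proof.
apply: le_ereal_inf_tmp => _ [x _ <-]; apply: le_ereal_inf_tmp => _ [us [vs [_ ->]]].
by apply: nneseries_ge0 => n _ _; rewrite mule_ge0// L2norm_ge0.
Qed.

Lemma ae_L2 (Z : R -> vec) : field2 Z -> (sqnorm2 Z < +oo)%E -> {ae mu, forall h, L2 (Z h)}.
Proof.
move=> mZ fZ.
have iZ : mu.-integrable setT (fun h => sq (Z h)).
  apply/integrableP; split; first exact: measurable_sq.
  by under eq_integral => h _ do rewrite gee0_abs ?sq_ge0//.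
have := integrable_ae measurableT iZ; apply: filterS => h /= /(_ I) fin.
apply/L2P; split; first exact: field2_slice.
by rewrite -ge0_fin_numE// sq_ge0.
Qed.

Lemma field2_left s : vstep_ok s -> field2 (@left_field R s).
Proof.
by move=> [mc hl _ _]; apply: field2_cells => // i; exact: L2_cmeas (hl i).
Qed.

Lemma field2_right s : vstep_ok s -> field2 (@right_field R s).
Proof.
by move=> [mc _ hr _]; apply: field2_cells => // i; exact: L2_cmeas (hr i).
Qed.

Lemma L2_left s h : vstep_ok s -> L2 (@left_field R s h).
Proof. by move=> [_ hl _ _]; exact: hl. Qed.

Lemma L2_right s h : vstep_ok s -> L2 (@right_field R s h).
Proof. by move=> [_ _ hr _]; exact: hr. Qed.

Let mass : R := fine (sqnorm2 X) + fine (sqnorm2 Y).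

Let fineX : (fine (sqnorm2 X))%:E = sqnorm2 X.
Proof. by apply: fineK; rewrite ge0_fin_numE// sqnorm2_ge0. Qed.

Let fineY : (fine (sqnorm2 Y))%:E = sqnorm2 Y.
Proof. by apply: fineK; rewrite ge0_fin_numE// sqnorm2_ge0. Qed.

Let massE : (sqnorm2 X + sqnorm2 Y = mass%:E)%E.
Proof. by rewrite /mass EFinD fineX fineY. Qed.

Let mass_ge0 : 0 <= mass.
Proof. by rewrite addr_ge0// fine_ge0// sqnorm2_ge0. Qed.

(** Squared errors of size d ^ 2, where d is the weight in [gap], make the
    integral of the gap of order d. *)
Definition close n (s : vstep R) : Prop := [/\ vstep_ok s,
  (sqnorm2 (fun h => X h - left_field s h)%R <= (dyadic R n ^+ 2)%:E)%E &
  (sqnorm2 (fun h => Y h - right_field s h)%R <= (dyadic R n ^+ 2)%:E)%E].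

Let gap n s h : \bar R := diff_bound (dyadic R n) (X h) (Y h) (left_field s h) (right_field s h).

Lemma measurable_gap n s : vstep_ok s -> measurable_fun setT (gap n s).
Proof.
by move=> ok; have [] := integral_diff_bound (dyadic_gt0 R n) mX mY (field2_left ok) (field2_right ok).
Qed.

Lemma integral_gap n s : close n s ->
  (\int[mu]_h gap n s h <= ((mass + 4) * dyadic R n)%:E)%E.
Proof.
move=> [ok h1 h2].
have d0 := dyadic_gt0 R n.
have [_ ->] := integral_diff_bound d0 mX mY (field2_left ok) (field2_right ok).
have hsum := leeD h1 h2; rewrite -EFinD in hsum.
apply: (weighted_sum_le d0 _ hsum); first by rewrite massE.
by field; rewrite gt_eqF.
Qed.

(** From X' = X - (X - X'), as the squared error is at most 1. *)
Lemma sqnorm2_left_close n s : close n s ->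
  (sqnorm2 (left_field s) <= (2 * fine (sqnorm2 X) + 2)%:E)%E.
Proof.
move=> [ok h1 _]; have mL := field2_left ok.
have -> : left_field s = (fun h => X h - (X h - left_field s h)).
  by apply/funext => h; rewrite subKr.
apply: (le_trans (sqnorm2B mX (field2B mX mL))).
apply: twice_add2_le; first by rewrite fineX.
by apply: (le_trans h1); rewrite lee_fin expr_le1// ?dyadic_le1// ltW// dyadic_gt0.
Qed.

Lemma sqnorm2_right_close n s : close n s ->
  (sqnorm2 (right_field s) <= (2 * fine (sqnorm2 Y) + 2)%:E)%E.
Proof.
move=> [ok _ h1]; have mL := field2_right ok.
have -> : right_field s = (fun h => Y h - (Y h - right_field s h)).
  by apply/funext => h; rewrite subKr.
apply: (le_trans (sqnorm2B mY (field2B mY mL))).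
apply: twice_add2_le; first by rewrite fineY.
by apply: (le_trans h1); rewrite lee_fin expr_le1// ?dyadic_le1// ltW// dyadic_gt0.
Qed.

(** The n-th and (n + 1)-st approximations are both close to X and Y, hence to
    each other. *)
Lemma increment_close n s s' : close n s -> close n.+1 s' ->
  (\sum_(p <- increment_tensors s s') weight p <=
    ((2 * mass + 20) * dyadic R n)%:E)%E.
Proof.
move=> cs cs'; have [ok h1 h2] := cs; have [ok' h1' h2'] := cs'.
have d0 := dyadic_gt0 R n.
apply: (le_trans (increment_weight ok ok' d0 (dyadic_le1 R n))).
have [mL mR] := (field2_left ok, field2_right ok).
have [mL' mR'] := (field2_left ok', field2_right ok').
have [_ ->] := integral_diff_bound d0 mL' mR' mL mR.
have le2 : ((dyadic R n.+1 ^+ 2)%:E <= (dyadic R n ^+ 2)%:E)%E.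
  by rewrite lee_fin ler_pXn2r ?nnegrE ?dyadic_decr ?(ltW (dyadic_gt0 _ _)).
have hL : (sqnorm2 (fun h => left_field s' h - left_field s h)%R <=
    (4 * dyadic R n ^+ 2)%:E)%E.
  have -> : (fun h => left_field s' h - left_field s h) =
      (fun h => (X h - left_field s h) - (X h - left_field s' h)).
    by apply/funext => h; rewrite opprB [RHS]addrC addrA subrK.
  apply: (le_trans (sqnorm2B (field2B mX mL) (field2B mX mL'))).
  exact: twice_sum_le h1 (le_trans h1' le2).
have hR : (sqnorm2 (fun h => right_field s' h - right_field s h)%R <=
    (4 * dyadic R n ^+ 2)%:E)%E.
  have -> : (fun h => right_field s' h - right_field s h) =
      (fun h => (Y h - right_field s h) - (Y h - right_field s' h)).
    by apply/funext => h; rewrite opprB [RHS]addrC addrA subrK.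
  apply: (le_trans (sqnorm2B (field2B mY mR) (field2B mY mR'))).
  exact: twice_sum_le h2 (le_trans h2' le2).
have hsum := leeD (sqnorm2_left_close cs') (sqnorm2_right_close cs').
have hdiff := leeD hL hR; rewrite -EFinD in hsum; rewrite -EFinD in hdiff.
apply: (weighted_sum_le d0 hsum hdiff).
by rewrite /mass; field; rewrite gt_eqF.
Qed.

Lemma exists_close n : exists s, close n s.
Proof.
have e0 : 0 < dyadic R n ^+ 2 by rewrite exprn_gt0// dyadic_gt0.
have [s ok [h1 h2]] := pair_approximation e0 mX mY fX fY.
exists s; split; [exact: ok|exact: h1|exact: h2].
Qed.

Lemma Api_norm_gap n s h : vstep_ok s ->
  (Api_norm (coef (X h) (Y h) - coef (left_field s h) (right_field s h))%R <= gap n s h)%E.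
Proof.
move=> ok; apply: Api_norm_diff; [exact: dyadic_gt0|exact: dyadic_le1|..].
- exact: field2_slice.
- exact: field2_slice.
- exact: L2_left.
- exact: L2_right.
Qed.

Lemma gap_ge0 n s h : (0 <= gap n s h)%E.
Proof. by apply: diff_bound_ge0; exact: dyadic_gt0. Qed.

Lemma normc_gap g n s h : vstep_ok s ->
  ((normc (coef (X h) (Y h) g - coef (left_field s h) (right_field s h) g)%R)%:E
    <= 2%:E * gap n s h)%E.
Proof.
move=> ok; apply: normc_coef_diff; [exact: dyadic_gt0|exact: dyadic_le1|..].
- exact: field2_slice.
- exact: field2_slice.
- exact: L2_left.
- exact: L2_right.
Qed.

Variable v : affine R -> R[i].
Hypothesis hv : forall g, exists c : R -> R[i],
  [/\ cintegrable c, Cintegral c = v g &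
      {ae mu, forall h, c h = coef (X h) (Y h) g}].

(** Pointwise convergence of the step integrals, with a rate.  The
    function c stands in for the coefficients, whose dependence on h is not
    assumed to be measurable. *)
Lemma step_integral_close g n s : close n s ->
  normc (step_integral mu (bochner_step s) g - v g) <= (4 * (mass + 4)) * dyadic R n.
Proof.
move=> cs; have [ok h1 h2] := cs.
have [c [ic <- cE]] := hv g.
have [is_ ->] := bochner_step_integral ok g.
pose f h := (-1) * c h + coef (left_field s h) (right_field s h) g.
have -> : Cintegral (fun h => coef (left_field s h) (right_field s h) g) - Cintegral c =
    Cintegral f.
  by rewrite Cintegral_linear// mulN1r addrC.
have fle : (\int[mu]_h (normc (f h))%:E <= 2%:E * ((mass + 4) * dyadic R n)%:E)%E.
  apply: (@le_trans _ _ (\int[mu]_h (2%:E * gap n s h))%E); last first.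
    rewrite ge0_integralZl//; last 2 first.
    - exact: measurable_gap.
    - by move=> h _; exact: gap_ge0.
    by rewrite lee_pmul2l//; exact: integral_gap.
  have mf : cmeas f.
    apply: cmeasD; last by case: is_.
    by apply: cmeasM; [exact: cmeas_cst|case: ic].
  apply: ae_ge0_le_integral => //.
  - by move=> h _; rewrite lee_fin normc_ge0.
  - exact: measurable_enormc.
  - by move=> h _; rewrite mule_ge0// gap_ge0.
  - by apply: measurable_funeM; exact: measurable_gap.
  apply: filterS cE => h cE _; rewrite /f cE mulN1r addrC -normc_opp opprB.
  exact: normc_gap.
have if_ : cintegrable f.
  split; first by apply: cmeasD; [apply: cmeasM; [exact: cmeas_cst|case: ic]|case: is_].
  by apply: le_lt_trans fle _; rewrite -EFinM ltry.
rewrite -lee_fin; apply: (le_trans (normc_Cintegral if_)).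
apply: (@le_trans _ _ (2%:E * (2%:E * ((mass + 4) * dyadic R n)%:E))%E).
  by rewrite lee_pmul2l.
suff : 2 * (2 * ((mass + 4) * dyadic R n)) <= 4 * (mass + 4) * dyadic R n by rewrite -lee_fin.
by rewrite le_eqVlt; apply/orP; left; apply/eqP; ring.
Qed.

(** Reduction of a Bochner integral to its pointwise values: integrability comes
    from step approximations of X and Y, and convergence of the step integrals
    from the summability of their increments. *)
Theorem bochner_integral_coef :
  is_bochner_integral mu (@Api_norm R) (fun h => coef (X h) (Y h)) v.
Proof.
have [s sP] := choice exists_close.
have ok n : vstep_ok (s n) by case: (sP n).
have Cc : 0 <= mass + 4 := addr_ge0 mass_ge0 (ler0n R 4).
exists (fun n => bochner_step (s n)).
have NE n h : (Api_norm (coef (X h) (Y h) - step_fun (bochner_step (s n)) h)%R <=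
    gap n (s n) h)%E.
  by rewrite bochner_step_fun//; exact: Api_norm_gap.
split.
- by move=> n; exact: bochner_step_integrable.
- (* The mean distances are summable. *)
  have fin : (\sum_(0 <= n <oo) \int[mu]_h gap n (s n) h < +oo)%E.
    apply: (@le_lt_trans _ _ (((mass + 4) / 2 ^+ 0)%:E)); last exact: ltry.
    rewrite -dyadic_series; apply: lee_nneseries => [n _ _|n _].
      by apply: integral_ge0 => h _; exact: gap_ge0.
    by rewrite add0n; exact: integral_gap.
  have := ae_cvg0_summable (fun n => measurable_gap n (ok n)) (fun n h => gap_ge0 n (s n) h) fin.
  apply: filterS => h gap0.
  apply: (squeeze_cvge _ (cvg_cst 0%E) gap0); apply: nearW => n.
  by rewrite Api_norm_ge0 NE.
- have lim : (fun n => ((mass + 4) * dyadic R n)%:E) @ \oo --> (0%:E : \bar R).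
    by apply: cvg_EFin; [exact: nearW|exact: dyadic_cvg].
  apply: (squeeze_cvge _ (cvg_cst 0%E) lim); apply: nearW => n.
  rewrite integral_ge0//=; last by move=> h _; exact: Api_norm_ge0.
  apply: le_trans (integral_gap (sP n)).
  by apply: le_integral_ge0 => h; [exact: Api_norm_ge0|exact: NE].
- pose S n : affine R -> R[i] := step_integral mu (bochner_step (s n)).
  have tail n : (Api_norm (v - S n)%R <= ((2 * mass + 20) / 2 ^+ n)%:E)%E.
    (* The tail of the telescoping series of increments. *)
    pose L m := increment_tensors (s (n + m)%N) (s (n + m).+1).
    have LW : (\sum_(0 <= m <oo) \sum_(p <- L m) weight p <=
        ((2 * mass + 20) / 2 ^+ n)%:E)%E.
      rewrite -dyadic_series; apply: lee_nneseries => [m _ _|m _].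
        by apply: sume_ge0 => p _; exact: weight_ge0.
      exact: increment_close.
    apply: (le_trans _ LW); apply: (Api_series _ _ _).2.
    + by move=> m p; exact: L2_increment.
    + exact: (le_lt_trans LW (ltry _)).
    move=> g.
    have E k : \sum_(m < k) tensor_coef (L m) g = S (n + k)%N g - S n g.
      under eq_bigr => m _ do rewrite increment_coef//.
      rewrite -(big_mkord xpredT (fun m => S (n + m).+1 g - S (n + m)%N g)).
      under eq_bigr => m _ do rewrite -addnS.
      by rewrite (telescope_sumr (fun m => S (n + m)%N g))// addn0.
    apply: (squeeze_cvgr _ (cvg_cst 0) (dyadic_cvg (4 * (mass + 4)))).
    apply: nearW => k; rewrite normc_ge0 E /=.
    have -> : S (n + k)%N g - S n g - (v - S n) g = S (n + k)%N g - v g.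
      by rewrite -[(v - S n) g]/(v g - S n g) opprB addrA subrK.
    apply: (le_trans (step_integral_close g (sP (n + k)%N))).
    (* The terms of index n + k are bounded by those of index k. *)
    rewrite ler_wpM2l// ?mulr_ge0//.
    elim: n {L LW E} => [|n IH]; first by rewrite add0n.
    by rewrite addSn (le_trans (dyadic_decr _ _)).
  have lim : (fun n => ((2 * mass + 20) / 2 ^+ n)%:E) @ \oo --> (0%:E : \bar R).
    apply: cvg_EFin; first exact: nearW.
    have := @dyadic_cvg R (2 * (2 * mass + 20)); apply: cvg_trans.
    apply: near_eq_cvg; apply: nearW => n /=.
    by rewrite /dyadic natrX exprS; field; rewrite expf_neq0.
  apply: (squeeze_cvge _ (cvg_cst 0%E) lim); apply: nearW => n.
  by rewrite Api_norm_ge0 tail.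
Qed.

End bochner_integral_of_coefficients.

(** * Products of coefficients *)

Section product_of_coefficients.
Variable R : realType.
Local Notation mu := (@haar R).

Lemma cisD (x y : R) : cis (x + y) = cis x * cis y.
Proof. by apply/eqP; rewrite eq_complex /= cosD sinD eqxx /= addrC. Qed.

Lemma cintegrableReIm (c : R -> R[i]) :
  mu.-integrable setT (EFin \o (fun h => complex.Re (c h))) ->
  mu.-integrable setT (EFin \o (fun h => complex.Im (c h))) -> cintegrable c.
Proof.
move=> ire iim.
have mc : cmeas c.
  by split; apply/measurable_EFinP; [exact: measurable_int ire|exact: measurable_int iim].
split => //.
have /integrableP[mre fre] := ire; have /integrableP[mim fim] := iim.
apply: (@le_lt_trans _ _ (\int[mu]_h (`|(complex.Re (c h))%:E| + `|(complex.Im (c h))%:E|))%E).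
  apply: ge0_le_integral => //.
  - by move=> h _; rewrite lee_fin normc_ge0.
  - exact: measurable_enormc.
  - by apply: emeasurable_funD; exact: measurableT_comp.
  - by move=> h _; rewrite lee_fin normc_le_ReIm.
rewrite ge0_integralD//; last 2 first.
- exact: measurableT_comp.
- exact: measurableT_comp.
by rewrite lte_add_pinfty.
Qed.

Lemma Api_coef (f k : R -> R[i]) : L2 f -> L2 k -> Api (coef f k).
Proof.
move=> hf hk.
have hl p : p \in [:: (f, k)] -> L2pair p by rewrite inE => /eqP ->.
by have := (Api_finite hl).1; rewrite /tensor_coef big_seq1.
Qed.

(** The character is multiplicative and s + u = t, so the matrix coefficient
    splits into a function of s times a function of u. *)
Lemma rep_twist g (f1 f2 k1 k2 : R -> R[i]) h t : h != 0 -> 1 + h != 0 ->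
  rep g (twist f1 f2 h) t * (twist k1 k2 h t)^* =
  (rep g f1 (sum_left (h, t)) * (k1 (sum_left (h, t)))^*) *
  (rep g f2 (sum_right (h, t)) * (k2 (sum_right (h, t)))^*).
Proof.
move=> h0 h1; rewrite /rep !twistE rmorphM.
have -> : sum_left (h, t * dilation g) = sum_left (h, t) * dilation g.
  by rewrite /sum_left /= mulrA.
have -> : sum_right (h, t * dilation g) = sum_right (h, t) * dilation g.
  by rewrite /sum_right /= mulrA.
rewrite -[in cis (_ * t)](sum_leftD_right t h0 h1) mulrDr cisD; ring.
Qed.

(** The asserted identity, evaluated at g. *)
Lemma coef_product_integral (f1 f2 k1 k2 : R -> R[i]) g :
  L2 f1 -> L2 f2 -> L2 k1 -> L2 k2 ->
  exists c : R -> R[i],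
  [/\ cintegrable c, Cintegral c = coef f1 k1 g * coef f2 k2 g &
      {ae mu, forall h, c h = coef (twist f1 f2 h) (twist k1 k2 h) g}].
Proof.
move=> hf1 hf2 hk1 hk2.
have [ire iim E] := Cintegral_transport
  (cintegrable_inner (L2_rep g hf1) hk1) (cintegrable_inner (L2_rep g hf2) hk2).
eexists; split; [exact: cintegrableReIm ire iim|exact: E|].
apply: filterS (haar_ae_generic R) => h [h0 h1].
by congr Cintegral; apply/funext => t; rewrite rep_twist.
Qed.

End product_of_coefficients.

Theorem proposition3p3 (R : realType) (xi1 xi2 eta1 eta2 : R -> R[i])
    (hxi1 : L2 xi1) (hxi2 : L2 xi2) (heta1 : L2 eta1) (heta2 : L2 eta2) :
  let F := fun h : R => lambda (1 + h) xi1 * lambda (1 + h^-1) xi2 in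
  let K := fun h : R => lambda (1 + h) eta1 * lambda (1 + h^-1) eta2 in
  {ae @haar R, forall h : R, [/\ L2 (F h), L2 (K h) & Api (coef (F h) (K h))]} /\
  is_bochner_integral (@haar R) (@Api_norm R)
    (fun h : R => coef (F h) (K h))
    (coef xi1 eta1 * coef xi2 eta2).
Proof.
move=> F K.
have mF : field2 F by apply: field2_twist; exact: L2_cmeas.
have mK : field2 K by apply: field2_twist; exact: L2_cmeas.
have fF : (sqnorm2 F < +oo)%E := sqnorm2_twist_lty hxi1 hxi2.
have fK : (sqnorm2 K < +oo)%E := sqnorm2_twist_lty heta1 heta2.
split.
  apply: filterS2 (ae_L2 mF fF) (ae_L2 mK fK) => h hF hK.
  by split => //; exact: Api_coef.
apply: bochner_integral_coef => // g.
exact: coef_product_integral.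
Qed.
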